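(* Fix $0<\delta<1$. Then there exists a constant $c$, depending only on $\delta$, such that for all sufficiently large integers $r,n$ with $\delta<\frac{r}{n}<1-\delta$, every zero $z^*$ of $B_{r,n}(z)$ satisfies $$\min_{\zeta\in C_{r/n}} |z^*-\zeta| \le \frac{c}{\left|z^*-\frac{r}{n-r}\right|}\cdot\frac{\ln n}{n}.$$ Additionally, the proximity of the zeros to the point $z_{r/n}=\frac{r}{n-r}$ is of order $O\!\left(\frac{1}{\sqrt n}\right)$; that is, for all sufficiently large $r,n$ with $\delta<\frac rn<1-\delta$, $$\min_{z^*\,:\,B_{r,n}(z^* )=0}\left|z^*-\frac{r}{n-r}\right| = O\!\left(\frac{1}{\sqrt n}\right),$$ with implied constant depending only on $\delta$.
   Context: For integers $1\le r\le n$, $B_{r,n}(z)=\sum_{k=0}^r\binom{n}{k}z^k$, $z\in\mathbb{C}$. For $0<\alpha<1$, $K_\alpha=\alpha^\alpha(1-\alpha)^{1-\alpha}$ and $$C_\alpha = \left\{ z\in\mathbb{C} : \frac{|z|^\alpha}{|1+z|} = K_\alpha,\ |z| \le \frac{\alpha}{1-\alpha} \right\}.$$ ''Sufficiently large'' means that $r$ and $n$ exceed a threshold depending only on $\delta$. *)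

(* Defs.v *)
From HB Require Import structures.
From mathcomp Require Import all_boot all_order all_algebra.
From mathcomp Require Import all_classical all_reals all_analysis.
From mathcomp Require Export complex.

Set Implicit Arguments.
Unset Strict Implicit.
Unset Printing Implicit Defensive.

Import Order.TTheory GRing.Theory Num.Theory.

Local Open Scope classical_set_scope.
Local Open Scope ring_scope.

(* The modulus of a complex number as an element of [R]; the generic norm
   [`|z|] of the numeric field [R[i]] lives in [R[i]]. *)
Definition cmod (R : realType) (z : R[i]) : R := ComplexField.Normc.normc z.

Definition binpoly (R : realType) (r n : nat) : {poly R[i]} :=
  \sum_(k < r.+1) 'C(n, k)%:R *: 'X^k.

Definition Kconst (R : realType) (a : R) : R := a `^ a * (1 - a) `^ (1 - a).

(* At [z = -1] the quotient is [0] in Rocq; since [Kconst a > 0] for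
   [0 < a < 1], this point is excluded, as it should be. *)
Definition Ccurve (R : realType) (a : R) : set R[i] :=
  [set z | cmod z `^ a / cmod (1 + z) = Kconst a /\ cmod z <= a / (1 - a)].

(* [m] is the minimum of [A]; in particular it is attained. *)
Definition is_min (R : realType) (A : set R) (m : R) : Prop :=
  A m /\ lbound A m.

(* The subtraction is in [R], not truncated on [nat]. *)
Definition zpoint (R : realType) (r n : nat) : R[i] :=
  (r%:R / (n%:R - r%:R) : R)%:C%C.

(* Main.v *)
(* Write [a = r/n], [x = r/(n-r)], [B = B_{r,n}] and let [T] be the tail
   [(1 + z)^n - B(z)].

   First part. The ratios of consecutive binomial coefficients are monotone, so
   multiplying [B] or [T] by a linear factor leaves coefficients of constant
   sign (the Enestrom-Kakeya device). This confines the zeros to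
   [1/n <= |z| <= r/(n-r+1) < x] and shows that [|T(z)|] is
   ['C(n,r) |z|^r] up to a power of [n]. At a zero [|1 + z|^n = |T(z)|], hence
   [log (|z|^a / (K_a |1 + z|)) = O(ln n / n)]. The gradient of this function
   is comparable to [|z - x|], so moving along it for a distance
   [O(ln n / (n |z - x|))] reaches the curve.

   Second part. Let [Q(z) = B(z)/(1+z)^n] and suppose that [B] has no zero
   within [2 rho] of [x], [rho = K / sqrt n]. On [|u| <= rho] we have
   [|Q(x+u)| <= ((1+|z|)/|1+z|)^n <= exp (n |u|^2 / x)], and [Q(x)] is bounded
   below, so [log |Q(x+u)/Q(x)|] is at most [M = O(K^2)]. Its Taylor
   coefficients of order [k >= 1] are then at most [2 M / rho^k]: it is
   quadratic up to [O(S^3 / K)] on real [u] with [|u| <= S / sqrt n]. But there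
   it is bounded (for [u <= 0]) while its slope at [0] is at most
   [- C sqrt n], which is impossible for [S], then [K], large. *)
Require Import Defs.
From mathcomp Require Import all_boot all_order all_algebra.
From mathcomp Require Import all_classical all_reals all_analysis.
From mathcomp Require cyclic separable cyclotomic.
From mathcomp Require Import ring lra zify.
Import Order.TTheory GRing.Theory Num.Theory.
Import numFieldNormedType.Exports.
Local Open Scope classical_set_scope.
Local Open Scope ring_scope.

Set Implicit Arguments.
Unset Strict Implicit.
Unset Printing Implicit Defensive.

Local Notation Re := complex.Re.
Local Notation Im := complex.Im.

(** * Moduli of complex numbers and sums with monotone coefficients *)

Section Modulus.
Context {R : realType}.
Implicit Types (z w : R[i]) (x : R).

Lemma cmodE z : (cmod z)%:C%C = `|z|.
Proof. by rewrite normc_def; case: z. Qed.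

Lemma cmod_ge0 z : 0 <= cmod z.
Proof. by case: z => a b; exact: sqrtr_ge0. Qed.

Lemma cmodM z w : cmod (z * w) = cmod z * cmod w.
Proof. exact: ComplexField.Normc.normcM. Qed.

Lemma cmod0 : cmod (0 : R[i]) = 0.
Proof. exact: ComplexField.Normc.normc0. Qed.

Lemma cmod1 : cmod (1 : R[i]) = 1.
Proof. exact: ComplexField.Normc.normc1. Qed.

Lemma cmod_eq0 z : (cmod z == 0) = (z == 0).
Proof.
by apply/eqP/eqP => [/ComplexField.Normc.eq0_normc//|->]; rewrite cmod0.
Qed.

Lemma cmod_gt0 z : (0 < cmod z) = (z != 0).
Proof. by rewrite lt_neqAle cmod_ge0 andbT eq_sym cmod_eq0. Qed.

Lemma ler_cmodD z w : cmod (z + w) <= cmod z + cmod w.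
Proof. exact: le_normcD. Qed.

Lemma cmodN z : cmod (- z) = cmod z.
Proof. exact: normcN. Qed.

Lemma cmodC z w : cmod (z - w) = cmod (w - z).
Proof. by rewrite -cmodN opprB. Qed.

Lemma ler_cmodB z w : cmod z - cmod w <= cmod (z - w).
Proof. by rewrite lerBlDr (le_trans _ (ler_cmodD _ _)) // subrK. Qed.

Lemma cmodV z : cmod z^-1 = (cmod z)^-1.
Proof. exact: ComplexField.Normc.normcV. Qed.

Lemma cmodX z n : cmod (z ^+ n) = cmod z ^+ n.
Proof. by elim: n => [|n IH]; rewrite ?expr0 ?cmod1// !exprS cmodM IH. Qed.

Lemma cmodR x : cmod (x%:C%C) = `|x|.
Proof. by rewrite /cmod /= expr0n addr0 sqrtr_sqr. Qed.

Lemma ler_cmod_sum I (r : seq I) (P : pred I) (F : I -> R[i]) :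
  cmod (\sum_(i <- r | P i) F i) <= \sum_(i <- r | P i) cmod (F i).
Proof.
elim/big_ind2 : _ => [|x1 y1 x2 y2 h1 h2|//]; first by rewrite cmod0.
by rewrite (le_trans (ler_cmodD _ _))// lerD.
Qed.

Lemma sqr_cmod z : cmod z ^+ 2 = Re z ^+ 2 + Im z ^+ 2.
Proof. by case: z => a b; rewrite /cmod /= sqr_sqrtr// addr_ge0 ?sqr_ge0. Qed.

Lemma ler_Re_cmod z : `|Re z| <= cmod z.
Proof.
rewrite -[leLHS]sqrtr_sqr; case: z => a b; rewrite /cmod /= ler_wsqrtr//.
by rewrite lerDl sqr_ge0.
Qed.

Lemma ler_Im_cmod z : `|Im z| <= cmod z.
Proof.
rewrite -[leLHS]sqrtr_sqr; case: z => a b; rewrite /cmod /= ler_wsqrtr//.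
by rewrite lerDr sqr_ge0.
Qed.

Lemma cmodJ z : cmod (conjc z) = cmod z.
Proof. by case: z => a b; rewrite /cmod /= sqrrN. Qed.

Lemma mulcJ z : conjc z * z = (cmod z)%:C%C ^+ 2.
Proof. by rewrite cmodE sqr_normc mulrC. Qed.

Lemma ReD z w : Re (z + w) = Re z + Re w. Proof. by case: z w => [? ?] []. Qed.
Lemma ImD z w : Im (z + w) = Im z + Im w. Proof. by case: z w => [? ?] []. Qed.
Lemma ReN z : Re (- z) = - Re z. Proof. by case: z. Qed.
Lemma ImN z : Im (- z) = - Im z. Proof. by case: z. Qed.
Lemma ReRM x z : Re (x%:C%C * z) = x * Re z.
Proof. by case: z => a b /=; rewrite mul0r subr0. Qed.
Lemma ImRM x z : Im (x%:C%C * z) = x * Im z.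
Proof. by case: z => a b /=; rewrite mul0r addr0. Qed.

Lemma Re_sum I (r : seq I) (P : pred I) (F : I -> R[i]) :
  Re (\sum_(i <- r | P i) F i) = \sum_(i <- r | P i) Re (F i).
Proof. by elim/big_ind2 : _ => // x1 y1 x2 y2 <- <-; rewrite ReD. Qed.

Lemma sqr_cmod1D w : cmod (1 + w) ^+ 2 = 1 + 2 * Re w + cmod w ^+ 2.
Proof. by rewrite !sqr_cmod ReD ImD /=; ring. Qed.

(* Multiplying [c_0 + c_1 z + ...] by [z - x] leaves coefficients of constant
   sign, up to the first or last term, when [c_k / c_(k+1)] stays on one side of
   [x]. *)
Lemma mul_subX_sum (A : comNzRingType) (c : nat -> A) (x z : A) N :
  (z - x) * \sum_(k < N.+1) c k * z ^+ k =
  c N * z ^+ N.+1 - x * c 0%N +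
  \sum_(k < N) (c k - x * c k.+1) * z ^+ k.+1.
Proof.
elim: N => [|N IH]; first by rewrite !big_ord_recl !big_ord0 /=; ring.
rewrite big_ord_recr /= mulrDr IH [in RHS]big_ord_recr /= !exprS; ring.
Qed.

Lemma ler_cmod_psum (c : nat -> R) z N : (forall k, 0 <= c k) ->
  cmod (\sum_(k < N) (c k)%:C%C * z ^+ k) <= \sum_(k < N) c k * cmod z ^+ k.
Proof.
move=> c0; apply: le_trans (ler_cmod_sum _ _ _) _; apply: ler_sum => k _.
by rewrite cmodM cmodX cmodR ger0_norm.
Qed.

(** In the expansion of [mul_subX_sum] the term [x * c 0] has one sign and all the others have the
    opposite sign. The triangle inequality then bounds the modulus from below by the same expression
    at [cmod z]. *)
Lemma cmod_psum_decr (c : nat -> R) (x : R) z N : 0 <= x ->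
  (forall k, 0 <= c k) -> (forall k, (k < N)%N -> x * c k.+1 <= c k) ->
  (x - cmod z) * \sum_(k < N.+1) c k * cmod z ^+ k <=
  cmod (x%:C%C - z) * cmod (\sum_(k < N.+1) (c k)%:C%C * z ^+ k).
Proof.
move=> x0 c0 cx; rewrite -cmodM -[x - _]opprB -[_%:C%C - z]opprB !mulNr cmodN.
rewrite (mul_subX_sum (fun k => (c k)%:C%C)) mul_subX_sum.
set S := \sum_(k < N) _; set T := \sum_(k < N) _.
have ST : cmod T <= S.
  apply: le_trans (ler_cmod_sum _ _ _) _; apply: ler_sum => k _.
  by rewrite -rmorphM -rmorphB cmodM cmodX cmodR ger0_norm// subr_ge0 cx.
have h1 : cmod ((c N)%:C%C * z ^+ N.+1) = c N * cmod z ^+ N.+1.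
  by rewrite cmodM cmodX cmodR ger0_norm.
have h2 : cmod (x%:C%C * (c 0%N)%:C%C) = x * c 0%N.
  by rewrite -rmorphM cmodR ger0_norm// mulr_ge0.
have := ler_cmodB (x%:C%C * (c 0%N)%:C%C) ((c N)%:C%C * z ^+ N.+1 + T).
have := ler_cmodD ((c N)%:C%C * z ^+ N.+1) T.
by rewrite h1 h2 cmodC [_ + T - _]addrAC; lra.
Qed.

(** With the ratios on the other side of [x], the leading term [c N * z ^+ N.+1] is the one of
    isolated sign, and it carries the lower bound. *)
Lemma cmod_psum_incr (c : nat -> R) (x : R) z N : 0 <= x ->
  (forall k, 0 <= c k) -> (forall k, (k < N)%N -> c k <= x * c k.+1) ->
  (cmod z - x) * \sum_(k < N.+1) c k * cmod z ^+ k <=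
  cmod (x%:C%C - z) * cmod (\sum_(k < N.+1) (c k)%:C%C * z ^+ k).
Proof.
move=> x0 c0 cx; rewrite cmodC -cmodM.
rewrite (mul_subX_sum (fun k => (c k)%:C%C)) mul_subX_sum.
set S := \sum_(k < N) _; set T := \sum_(k < N) _.
have ST : cmod T <= - S.
  apply: le_trans (ler_cmod_sum _ _ _) _; rewrite -sumrN; apply: ler_sum => k _.
  rewrite -rmorphM -rmorphB cmodM cmodX cmodR ler0_norm ?mulNr//.
  by rewrite subr_le0 cx.
have h1 : cmod ((c N)%:C%C * z ^+ N.+1) = c N * cmod z ^+ N.+1.
  by rewrite cmodM cmodX cmodR ger0_norm.
have h2 : cmod (x%:C%C * (c 0%N)%:C%C) = x * c 0%N.
  by rewrite -rmorphM cmodR ger0_norm// mulr_ge0.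
have := ler_cmodB ((c N)%:C%C * z ^+ N.+1) (x%:C%C * (c 0%N)%:C%C - T).
have := ler_cmodD (x%:C%C * (c 0%N)%:C%C) (- T).
by rewrite h1 h2 cmodN opprB [T - _]addrC addrA; lra.
Qed.

End Modulus.

(** * Binomial weights *)

Section BinomialWeights.
Context {R : realType}.
Implicit Types (a x : R) (n k r : nat).

(** The binomial distribution with success probability [a]. It is used at [a = r/n], where [r] is
    both its mean and its mode. *)
Definition binw n a k : R := 'C(n, k)%:R * a ^+ k * (1 - a) ^+ (n - k).

Lemma binw_ge0 n a k : 0 <= a <= 1 -> 0 <= binw n a k.
Proof.
move=> /andP[a0 a1].
by rewrite /binw mulr_ge0 ?mulr_ge0 ?exprn_ge0 ?ler0n ?subr_ge0.
Qed.

Lemma sum_binw n a : \sum_(k < n.+1) binw n a k = 1.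
Proof.
have := exprDn (1 - a) a n; rewrite subrK expr1n => ->.
by apply: eq_bigr => i _; rewrite /binw -mulr_natl; ring.
Qed.

Lemma binw_le1 n a k : 0 <= a <= 1 -> (k <= n)%N -> binw n a k <= 1.
Proof.
move=> a01 kn; rewrite -(sum_binw n a).
rewrite (bigD1 (Ordinal (kn : (k < n.+1)%N)))//= lerDl sumr_ge0// => i _.
exact: binw_ge0.
Qed.

Lemma binSR n k : (k <= n)%N ->
  (k.+1%:R * 'C(n, k.+1)%:R = (n%:R - k%:R) * 'C(n, k)%:R :> R).
Proof. by move=> kn; rewrite -natrB// -!natrM mul_bin_left. Qed.

Lemma binwS n a k : (k <= n)%N ->
  k.+1%:R * (1 - a) * binw n a k.+1 = (n%:R - k%:R) * a * binw n a k.
Proof.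
move=> kn; rewrite /binw; case: (ltngtP k n) kn => // [kn _|-> _].
  have -> : (n - k = (n - k.+1).+1)%N by rewrite subnSK.
  have := binSR (ltnW kn); rewrite !exprS => h.
  transitivity ((k.+1%:R * 'C(n, k.+1)%:R) * (1 - a) * (a * a ^+ k) *
     (1 - a) ^+ (n - k.+1)); first ring.
  by rewrite h; ring.
by rewrite bin_small// subrr !mul0r mulr0.
Qed.

(* The weighted deviation is a discrete derivative, so the first two central
   moments follow by summation by parts. *)
Lemma binw_dev n a k : (k <= n)%N ->
  (k%:R - n%:R * a) * binw n a k =
  (1 - a) * k%:R * binw n a k - (1 - a) * k.+1%:R * binw n a k.+1.
Proof.
by move=> kn; rewrite [(1 - a) * k.+1%:R]mulrC binwS//; ring.
Qed.

Lemma sum_binw_dev n a r : (r <= n)%N ->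
  \sum_(k < r.+1) (n%:R * a - k%:R) * binw n a k = (n%:R - r%:R) * a * binw n a r.
Proof.
move=> rn; rewrite -binwS//.
transitivity (\sum_(0 <= k < r.+1) ((1 - a) * k.+1%:R * binw n a k.+1 -
    (1 - a) * k%:R * binw n a k)).
  rewrite big_mkord; apply: eq_bigr => k _.
  rewrite -[LHS]opprK -mulNr opprB binw_dev ?opprB//.
  by rewrite (leq_trans _ rn)// -ltnS.
by rewrite telescope_sumr// mulr0 mul0r subr0 [(1 - a) * _]mulrC.
Qed.

Lemma binw_variance n a :
  \sum_(k < n.+1) (k%:R - n%:R * a) ^+ 2 * binw n a k = n%:R * a * (1 - a).
Proof.
pose b k := (1 - a) * k%:R * binw n a k.
(* By [binw_dev] each summand is [(k - n a) (b k - b k.+1)], which is summed by parts; the boundary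
   term disappears at [m = n.+1] because ['C(n, n.+1) = 0]. *)
have bS m : (m <= n.+1)%N -> \sum_(k < m) (k%:R - n%:R * a) ^+ 2 * binw n a k =
    \sum_(k < m) b k - (m%:R - n%:R * a - 1) * b m.
  elim: m => [|m IH] mn; first by rewrite !big_ord0 /b; ring.
  rewrite big_ord_recr /= IH ?(ltnW mn)// big_ord_recr /=.
  rewrite expr2 -mulrA binw_dev// -/(b m) -/(b m.+1).
  by rewrite -natr1; ring.
have bn : b n.+1 = 0 by rewrite /b /binw bin_small// !mul0r mulr0.
rewrite bS// bn mulr0 subr0 {bS bn}/b.
have : \sum_(k < n.+1) (k%:R - n%:R * a) * binw n a k = 0.
  rewrite -[LHS]opprK -sumrN.
  under eq_bigr do rewrite -mulNr opprB.
  by rewrite sum_binw_dev// subrr !mul0r oppr0.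
under eq_bigr do rewrite mulrBl.
rewrite sumrB -mulr_sumr sum_binw mulr1 => /eqP; rewrite subr_eq0 => /eqP h.
under eq_bigr do rewrite -mulrA.
by rewrite -mulr_sumr h; ring.
Qed.

(** The recurrence [binwS] compares neighbours: the weights increase up to the mean [r] and decrease
    after it. *)
Lemma binw_mode n a r k : n%:R * a = r%:R -> (r < n)%N -> (k <= n)%N ->
  0 <= a < 1 -> binw n a k <= binw n a r.
Proof.
move=> nar rn kn /andP[a0 a1].
have a01 : 0 <= a <= 1 by rewrite a0 ltW.
have t0 m := binw_ge0 n m a01.
have a10 : 0 < 1 - a by rewrite subr_gt0.
have up m : (m < r)%N -> binw n a m <= binw n a m.+1.
  move=> mr; have mn : (m <= n)%N by rewrite ltnW// (ltn_trans mr).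
  have := binwS a mn.
  have : m%:R + 1 <= n%:R * a by rewrite nar natr1 ler_nat.
  have h0 : 0 < m.+1%:R * (1 - a) by rewrite mulr_gt0.
  move=> h1 h2; rewrite -(ler_pM2l h0) h2 ler_wpM2r//.
  rewrite -natr1 -subr_ge0.
  have -> : (n%:R - m%:R) * a - (m%:R + 1) * (1 - a) = n%:R * a - m%:R - 1 + a.
    by ring.
  by rewrite addr_ge0//; lra.
have dn m : (m < n)%N -> (r <= m)%N -> binw n a m.+1 <= binw n a m.
  move=> mn rm.
  have := binwS a (ltnW mn).
  have h1 : n%:R * a <= m%:R by rewrite nar ler_nat.
  have h0 : 0 < m.+1%:R * (1 - a) by rewrite mulr_gt0.
  move=> h2; rewrite -(ler_pM2l h0) h2 ler_wpM2r//.
  rewrite -natr1 -subr_ge0.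
  have -> : (m%:R + 1) * (1 - a) - (n%:R - m%:R) * a = m%:R - n%:R * a + (1 - a).
    by ring.
  by rewrite addr_ge0//; lra.
have [rk|kr] := leqP r k.
  have {rk} : (r <= k <= n)%N by rewrite rk.
  elim: k {kn} => [|k IH] /andP[rk kn]; first by move: rk; rewrite leqn0 => /eqP->.
  move: rk; rewrite leq_eqVlt => /predU1P[->//|rk].
  by rewrite (le_trans (dn _ kn rk))// IH// -ltnS rk ltnW.
have -> : (k = r - (r - k))%N by rewrite subKn// ltnW.
have : (r - k <= r)%N by rewrite leq_subr.
elim: (r - k)%N => [|j IH] jr; first by rewrite subn0.
rewrite (le_trans _ (IH (ltnW jr)))// -[X in binw _ _ X <= _](_ : (r - j).-1 = _)%N.
  by rewrite -[X in _ <= binw _ _ X](@prednK (r - j)) ?subn_gt0// up//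
    prednK ?leq_subr// subn_gt0.
by rewrite subnS.
Qed.

(** Chebyshev's inequality: for [m] just above [sqrt n], the indices at distance at least [m] from
    [r] have total weight at most [n a (1 - a) / m^2 <= 1/4]. The remaining ones, at most
    [2 m <= 4 sqrt n] in number, carry weight at least 3/4, and none exceeds the mode. *)
Lemma binw_mode_lb n a r : n%:R * a = r%:R -> (r < n)%N -> 0 <= a < 1 ->
  1 <= 8 * Num.sqrt n%:R * binw n a r.
Proof.
move=> nar rn a01.
have a01' : 0 <= a <= 1 by case/andP: a01 => -> /ltW.
have n0 : (0 < n)%N by rewrite (leq_ltn_trans _ rn).
have s1 : 1 <= Num.sqrt n%:R :> R by rewrite -[leLHS]sqrtr1 ler_wsqrtr// ler1n.
pose m := (Num.trunc (Num.sqrt (n%:R : R))).+1.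
have : (Num.trunc (Num.sqrt (n%:R : R)))%:R <= Num.sqrt (n%:R : R) < m%:R.
  by apply: Num.Theory.truncn_itv; rewrite sqrtr_ge0.
move=> /andP[m1 m2]; have {}m1 : (m%:R : R) - 1 <= Num.sqrt n%:R.
  by rewrite /m -natr1 addrK.
have nm : n%:R <= m%:R ^+ 2 :> R.
  rewrite -[leLHS]sqr_sqrtr ?ler0n//.
  by rewrite lerXn2r ?nnegrE ?sqrtr_ge0 ?ler0n ?ltW.
pose near k := (r < k + m)%N && (k < r + m)%N.
have far_le : \sum_(k < n.+1 | ~~ near k) binw n a k <= 4^-1.
  rewrite -(ler_pM2l (_ : 0 < m%:R ^+ 2)) ?exprn_gt0 ?ltr0n// mulr_sumr.
  have : n%:R * a * (1 - a) <= m%:R ^+ 2 / 4.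
    rewrite -mulrA (le_trans _ (ler_wpM2r _ nm)) ?invr_ge0//.
    rewrite ler_wpM2l ?ler0n// -subr_ge0.
    have -> : 4^-1 - a * (1 - a) = (a - 2^-1) ^+ 2 by field.
    exact: sqr_ge0.
  apply: le_trans; rewrite -binw_variance.
  rewrite [leRHS](bigID (fun k : 'I_n.+1 => near k))/= -[leLHS]add0r lerD//.
    by rewrite sumr_ge0// => k _; rewrite mulr_ge0 ?sqr_ge0 ?binw_ge0.
  apply: ler_sum => k; rewrite negb_and -!leqNgt => h.
  rewrite ler_wpM2r ?binw_ge0// nar -[leRHS]real_normK ?num_real//.
  rewrite lerXn2r ?nnegrE ?ler0n//.
  case/orP: h; rewrite -(ler_nat R) natrD => h.
    by rewrite distrC (le_trans _ (ler_norm _))//; lra.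
  by rewrite (le_trans _ (ler_norm _))//; lra.
have near_le : \sum_(k < n.+1 | near k) binw n a k <= (2 * m)%:R * binw n a r.
  apply: le_trans (_ : \sum_(k < n.+1 | near k) binw n a r <= _).
    by apply: ler_sum => k _; rewrite binw_mode// -ltnS.
  rewrite -(big_mkord near (fun=> binw n a r)) -big_filter.
  rewrite big_const_seq iter_addr_0 count_predT -[leLHS]mulr_natl ler_wpM2r ?binw_ge0//.
  rewrite ler_nat -[leqRHS](size_iota (r - m)%N) uniq_leq_size//.
    by rewrite filter_uniq// iota_uniq.
  by move=> k; rewrite mem_filter !mem_iota /near; lia.
have := sum_binw n a; rewrite (bigID (fun k : 'I_n.+1 => near k))/= => /eqP.
move: near_le far_le; set X := \sum_(k < n.+1 | near k) _.
set Y := \sum_(k < n.+1 | ~~ near k) _ => hX hY /eqP hXY.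
have : (2 * m)%:R * binw n a r <= 4 * Num.sqrt n%:R * binw n a r.
  by rewrite ler_wpM2r ?binw_ge0// natrM; lra.
have -> : 8 * Num.sqrt n%:R * binw n a r = 2 * (4 * Num.sqrt n%:R * binw n a r).
  by ring.
by lra.
Qed.

(* Cauchy-Schwarz for the mean deviation and the variance, in the linearized
   form [2 t u - t^2 u^2 <= 1] with [t = binw n a r]. *)
Lemma sum_binw_lb n a r : n%:R * a = r%:R -> (r <= n)%N -> 0 < a < 1 ->
  n%:R * a * (1 - a) * binw n a r ^+ 2 <= \sum_(k < r.+1) binw n a k.
Proof.
move=> nar rn /andP[a0 a1]; have a01 : 0 <= a <= 1 by rewrite !ltW.
have t0 m := binw_ge0 n m a01.
have [->|n0] := posnP n; first by rewrite !mul0r sumr_ge0 => [|k _] //; exact: binw_ge0.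
set V := n%:R * a * (1 - a); set t := binw n a r.
have V0 : 0 < V by rewrite /V !mulr_gt0 ?ltr0n ?subr_gt0.
have dev := sum_binw_dev a rn.
have var := binw_variance n a; rewrite -/V in var.
have {}var : \sum_(k < r.+1) (n%:R * a - k%:R) ^+ 2 * binw n a k <= V.
  rewrite -var.
  rewrite (big_ord_widen _ (fun k => (n%:R * a - k%:R) ^+ 2 * binw n a k)
    (rn : (r < n.+1)%N)).
  rewrite [leRHS](bigID (fun k : 'I_n.+1 => (k < r.+1)%N))/= -[leLHS]addr0 lerD//.
    by apply: ler_sum => k _; rewrite -sqrrN opprB.
  by rewrite sumr_ge0// => k _; rewrite mulr_ge0 ?sqr_ge0.
have : \sum_(k < r.+1)
    (2 * t * (n%:R * a - k%:R) - t ^+ 2 * (n%:R * a - k%:R) ^+ 2) * binw n a k <=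
    \sum_(k < r.+1) binw n a k.
  apply: ler_sum => k _; rewrite ler_piMl// -subr_ge0.
  set u := _ - k%:R; have -> : 1 - (2 * t * u - t ^+ 2 * u ^+ 2) = (1 - t * u) ^+ 2 by ring.
  exact: sqr_ge0.
apply: le_trans.
rewrite (eq_bigr (fun k : 'I_r.+1 => 2 * t * ((n%:R * a - k%:R) * binw n a k) -
  t ^+ 2 * ((n%:R * a - k%:R) ^+ 2 * binw n a k))); last by move=> k _; ring.
rewrite sumrB -!mulr_sumr dev.
have -> : (n%:R - r%:R) * a * binw n a r = V * t by rewrite -nar /V /t; ring.
have := ler_wpM2l (sqr_ge0 t) var.
by lra.
Qed.


End BinomialWeights.

(** * Zeros of the truncated binomial *)

Lemma exprD1n_split (A : comNzRingType) (z : A) n r : (r < n)%N ->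
  (1 + z) ^+ n = \sum_(k < r.+1) 'C(n, k)%:R * z ^+ k +
    z ^+ r.+1 * \sum_(j < (n - r).-1.+1) 'C(n, r.+1 + j)%:R * z ^+ j.
Proof.
move=> rn; rewrite exprDn.
under eq_bigr do rewrite expr1n mul1r -mulr_natl.
rewrite prednK ?subn_gt0//.
rewrite -(big_mkord predT (fun i => 'C(n, i)%:R * z ^+ i)).
have e : n.+1 = (r.+1 + (n - r))%N by lia.
rewrite (@big_cat_nat _ _ _ r.+1)//=; last by rewrite ltnS ltnW.
rewrite big_mkord; congr (_ + _).
rewrite -{1}[r.+1]add0n big_addn subSS.
rewrite big_mkord mulr_sumr; apply: eq_bigr => j _.
by rewrite [(j + _)%N]addnC exprD; ring.
Qed.

Section Truncation.
Context {R : realType}.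
Implicit Types (z : R[i]) (n r : nat).

Lemma horner_binpoly r n z :
  (binpoly R r n).[z] = \sum_(k < r.+1) ('C(n, k)%:R : R)%:C%C * z ^+ k.
Proof.
rewrite /binpoly horner_sum; apply: eq_bigr => k _.
by rewrite hornerZ hornerXn rmorph_nat.
Qed.

(** The ratio of ['C(n, k)] to ['C(n, k.+1)] is [(k + 1) / (n - k)], which grows with [k]. It is at
    least [r/(n-r)] in the tail, at most [r/(n-r+1)] in the head, and never below [1/n]; these are
    the three ratio bounds fed to the Enestrom-Kakeya estimates. *)
Lemma binom_ratio_tail r n k : (r < n)%N -> (r <= k <= n)%N ->
  r%:R / (n%:R - r%:R) * 'C(n, k.+1)%:R <= 'C(n, k)%:R :> R.
Proof.
move=> rn /andP[rk kn].
have nr : 0 < n%:R - r%:R :> R by rewrite subr_gt0 ltr_nat.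
have k0 : 0 < k.+1%:R :> R by rewrite ltr0n.
rewrite mulrAC ler_pdivrMr// -(ler_pM2l k0) mulrCA binSR// !mulrA.
rewrite [leRHS]mulrAC ler_wpM2r//.
have : r%:R * (n%:R - k%:R) <= k%:R * (n%:R - r%:R) :> R.
  by rewrite -!natrB ?(ltnW rn)// -!natrM ler_nat leq_mul// leq_sub2l.
by rewrite -natr1 mulrDl mul1r; lra.
Qed.

Lemma binom_ratio_head r n k : (r <= n)%N -> (k < r)%N ->
  'C(n, k)%:R <= r%:R / (n%:R - r%:R + 1) * 'C(n, k.+1)%:R :> R.
Proof.
move=> rn kr.
have nr : 0 < n%:R - r%:R + 1 :> R by rewrite ltr_wpDl// subr_ge0 ler_nat.
have k0 : 0 < k.+1%:R :> R by rewrite ltr0n.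
rewrite mulrAC ler_pdivlMr// -(ler_pM2l k0) [leRHS]mulrCA binSR; last first.
  by rewrite ltnW// (leq_trans kr).
rewrite !mulrA [leLHS]mulrAC ler_wpM2r//.
have -> : n%:R - r%:R + 1 = (n - r).+1%:R :> R by rewrite -natr1 natrB.
rewrite -natrB; last by rewrite ltnW// (leq_trans kr).
by rewrite -!natrM ler_nat leq_mul//; lia.
Qed.

Lemma binom_ratio_lb n k : (k < n)%N ->
  n%:R^-1 * 'C(n, k.+1)%:R <= 'C(n, k)%:R :> R.
Proof.
move=> kn; have n0 : 0 < n%:R :> R by rewrite ltr0n (leq_ltn_trans _ kn).
rewrite mulrC ler_pdivrMr//.
have := binSR (ltnW kn) (R := R); rewrite -natrB 1?ltnW// => h.
apply: (@le_trans _ _ (k.+1%:R * 'C(n, k.+1)%:R)).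
  by rewrite ler_peMl// ler1n.
by rewrite h mulrC ler_wpM2l// ler_nat leq_subr.
Qed.

(** At a root the right sides of [cmod_psum_decr] and [cmod_psum_incr] vanish, while the sum at
    [cmod z] is positive; this fixes the signs of the factors on the left. *)
Lemma root_binpoly_bounds r n z : (0 < r < n)%N -> root (binpoly R r n) z ->
  n%:R^-1 <= cmod z <= r%:R / (n%:R - r%:R + 1).
Proof.
move=> /andP[r0 rn] /rootP; rewrite horner_binpoly => Bz.
have c0 k : 0 <= 'C(n, k)%:R :> R by [].
have S0 : 0 < \sum_(k < r.+1) ('C(n, k)%:R : R) * cmod z ^+ k.
  rewrite big_ord_recl /= bin0 mul1r ltr_pwDl// sumr_ge0// => k _.
  by rewrite mulr_ge0// exprn_ge0// cmod_ge0.
pose c k : R := 'C(n, k)%:R.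
have x0 : 0 <= r%:R / (n%:R - r%:R + 1) :> R.
  by rewrite divr_ge0// addr_ge0// subr_ge0 ler_nat ltnW.
have n0 : 0 <= n%:R^-1 :> R by rewrite invr_ge0.
apply/andP; split; rewrite -subr_le0 -(pmulr_lle0 _ S0).
  have := @cmod_psum_decr R c _ z r n0 c0; rewrite Bz cmod0 mulr0; apply.
  by move=> k kr; apply: binom_ratio_lb; apply: ltn_trans rn.
have := @cmod_psum_incr R c _ z r x0 c0; rewrite Bz cmod0 mulr0; apply.
by move=> k kr; apply: binom_ratio_head => //; apply: ltnW.
Qed.

(** At a root [(1 + z)^n] is the tail. Since [cmod z <= x], the moduli of its terms decrease from
    ['C(n,r) |z|^r], and there are at most [n] of them: this is the upper bound. The lower bound is
    [cmod_psum_decr] for the tail; its loss [2 n^3] is made of [2 n] from comparing [|x - z| <= 2 x]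
    with [x - |z| >= x/n], [n] from ['C(n, r.+1)], and [n] from [|z| >= 1/n]. *)
Lemma root_binpoly_size r n z : (0 < r < n)%N -> root (binpoly R r n) z ->
  'C(n, r)%:R * cmod z ^+ r / (2 * n%:R ^+ 3) <= cmod (1 + z) ^+ n
    <= n%:R * ('C(n, r)%:R * cmod z ^+ r).
Proof.
move=> rn' Bz; have /andP[r0 rn] := rn'; pose x : R := r%:R / (n%:R - r%:R).
have nr : 0 < n%:R - r%:R :> R by rewrite subr_gt0 ltr_nat.
have n0 : 0 < n%:R :> R by rewrite ltr0n (ltn_trans r0).
have x0 : 0 < x by rewrite divr_gt0 ?ltr0n.
have /andP[z1 z2] := root_binpoly_bounds rn' Bz.
have z0 : 0 <= cmod z := cmod_ge0 z.
(* The gap between [x] and [r/(n-r+1)] is [x/(n-r+1)], and [n - r + 1 <= n] because [r >= 1]. *)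
have xz : x / n%:R <= x - cmod z.
  rewrite lerBrDr.
  apply: (@le_trans _ _ (x / n%:R + r%:R / (n%:R - r%:R + 1))).
    by rewrite lerD2l.
  rewrite -lerBrDl.
  rewrite ler_pdivrMr; last by rewrite addr_gt0.
  rewrite mulrDr mulr1 mulrBl divfK ?gt_eqF//.
  suff : (x / n%:R) * (n%:R - r%:R + 1) <= x by lra.
  rewrite mulrAC ler_pdivrMr// ler_wpM2l ?(ltW x0)//.
  have : 1 <= r%:R :> R by rewrite ler1n.
  by lra.
have zx : cmod z <= x by rewrite -subr_ge0 (le_trans _ xz)// divr_ge0// ltW.
have := exprD1n_split z rn.
move/rootP : Bz; rewrite horner_binpoly.
under eq_bigr do rewrite rmorph_nat.
move=> ->; rewrite add0r => e; rewrite -(cmodX (1 + z)) e cmodM (cmodX z r.+1).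
under eq_bigr do rewrite -(rmorph_nat (real_complex R)).
set S := \sum_(j < _) _; apply/andP; split.
  have c0 k : 0 <= 'C(n, (r.+1 + k)%N)%:R :> R by [].
  have ratio k : (k < (n - r).-1)%N ->
      x * 'C(n, (r.+1 + k.+1)%N)%:R <= 'C(n, (r.+1 + k)%N)%:R.
    by move=> kn; rewrite addnS; apply: binom_ratio_tail => //; lia.
  have := cmod_psum_decr z (ltW x0) c0 ratio; rewrite -/S => h.
  have {}h : 'C(n, r.+1)%:R / n%:R <= 2 * cmod S.
    rewrite -(ler_pM2l x0) [leRHS]mulrCA [leRHS]mulrA mulrA [leLHS]mulrAC.
    apply: le_trans (_ : cmod (x%:C%C - z) * cmod S <= _); last first.
      rewrite ler_wpM2r ?cmod_ge0// (le_trans (ler_cmodD _ _))// cmodN cmodR.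
      by rewrite ger0_norm ?(ltW x0)//; lra.
    apply: le_trans h; apply: ler_pM => //; first by rewrite divr_ge0// ltW.
    rewrite big_ord_recl expr0 mulr1 addn0 lerDl sumr_ge0// => i _.
    by rewrite mulr_ge0// exprn_ge0.
  have c' : 'C(n, r)%:R <= n%:R * 'C(n, r.+1)%:R :> R.
    apply: (@le_trans _ _ (r.+1%:R * 'C(n, r.+1)%:R)); last first.
      by rewrite ler_wpM2r// ler_nat.
    by rewrite binSR ?(ltnW rn)// ler_peMl// -natrB ?(ltnW rn)// ler1n subn_gt0.
  rewrite [cmod z ^+ r.+1]exprSr -[leRHS]mulrA -[leLHS]mulrA [leLHS]mulrCA.
  rewrite ler_wpM2l ?exprn_ge0//.
  apply: (@le_trans _ _ (n%:R^-1 * ('C(n, r.+1)%:R / n%:R / 2))); last first.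
    by apply: ler_pM; rewrite ?invr_ge0 ?divr_ge0// ?(ltW n0)//; lra.
  rewrite ler_pdivrMr ?mulr_gt0 ?exprn_gt0// (le_trans c')//.
  rewrite le_eqVlt; apply/orP; left; apply/eqP; field.
  by rewrite gt_eqF.
have mono j : (j <= n - r)%N ->
    'C(n, (r + j)%N)%:R * cmod z ^+ (r + j) <= 'C(n, r)%:R * cmod z ^+ r.
  elim: j => [|j IH] jr; first by rewrite addn0.
  apply: le_trans (IH (ltnW jr)).
  rewrite addnS exprS mulrA ler_wpM2r ?exprn_ge0// mulrC.
  apply: le_trans (_ : x * 'C(n, (r + j).+1)%:R <= _); first by rewrite ler_wpM2r.
  by apply: binom_ratio_tail => //; lia.
apply: le_trans (_ : cmod z ^+ r.+1 *
   \sum_(k < (n - r).-1.+1) 'C(n, (r.+1 + k)%N)%:R * cmod z ^+ k <= _).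
  rewrite ler_wpM2l ?exprn_ge0//.
  exact: (@ler_cmod_psum R (fun k => 'C(n, (r.+1 + k)%N)%:R)).
rewrite mulr_sumr.
apply: le_trans (_ : \sum_(k < (n - r).-1.+1) 'C(n, r)%:R * cmod z ^+ r <= _).
  apply: ler_sum => k _; rewrite mulrCA -exprD addSnnS mono//.
  by case: k => k /=; lia.
rewrite sumr_const card_ord -[leLHS]mulr_natl ler_wpM2r ?mulr_ge0 ?exprn_ge0//.
by rewrite ler_nat; lia.
Qed.

(** This turns ['C(n, r) * Kconst a ^+ n] into the modal weight [binw n a r], which is known up to a
    power of [n]. *)
Lemma Kconst_expr (a : R) n r : 0 < a < 1 -> n%:R * a = r%:R -> (r <= n)%N ->
  Kconst a ^+ n = a ^+ r * (1 - a) ^+ (n - r).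
Proof.
move=> /andP[a0 a1] nar rn; rewrite /Kconst exprMn.
have b0 : 0 <= 1 - a by rewrite subr_ge0 ltW.
rewrite -!powR_mulrn ?powR_ge0 ?(ltW a0)// -!powRrM.
by rewrite [a * _]mulrC nar [(1 - a) * _]mulrC mulrBr mulr1 nar natrB.
Qed.

Lemma Kconst_gt0 (a : R) : 0 < a < 1 -> 0 < Kconst a.
Proof. by move=> /andP[a0 a1]; rewrite /Kconst mulr_gt0// powR_gt0// subr_gt0. Qed.

(* The logarithm of [|z|^a / (K_a |1 + z|)], which vanishes on the curve. *)
Definition logdefect (a : R) z : R :=
  a * ln (cmod z) - ln (cmod (1 + z)) - ln (Kconst a).

(** Multiplying the bounds of [root_binpoly_size] by [Kconst a ^+ n] leaves [|z|^r] and
    [K_a^n |1 + z|^n] comparable up to powers of [n]. The defect is the difference of their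
    logarithms divided by [n]. *)
Lemma root_binpoly_logdefect r n z : (0 < r < n)%N -> (16 <= n)%N ->
  root (binpoly R r n) z ->
  `|logdefect (r%:R / n%:R) z| <= 5 * (ln n%:R / n%:R).
Proof.
move=> rn' n16 Bz; have /andP[r0 rn] := rn'.
have n0 : 0 < n%:R :> R by rewrite ltr0n (ltn_trans r0).
set a : R := r%:R / n%:R.
have nar : n%:R * a = r%:R by rewrite /a mulrCA divff ?mulr1// gt_eqF.
have a0 : 0 < a by rewrite divr_gt0// ltr0n.
have a1 : a < 1 by rewrite ltr_pdivrMr// mul1r ltr_nat.
have a01 : 0 < a < 1 by rewrite a0.
have K0 := Kconst_gt0 a01.
have /andP[z1 _] := root_binpoly_bounds rn' Bz.
have z0 : 0 < cmod z by rewrite (lt_le_trans _ z1)// invr_gt0.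
have /andP[lo up] := root_binpoly_size rn' Bz.
have w0 : 0 < cmod (1 + z) ^+ n.
  rewrite (lt_le_trans _ lo)// divr_gt0 ?mulr_gt0 ?exprn_gt0// ltr0n bin_gt0.
  exact: ltnW.
have w1 : 0 < cmod (1 + z).
  rewrite lt_neqAle cmod_ge0 andbT eq_sym; apply/eqP => h.
  by move: w0; rewrite h expr0n gtn_eqF ?ltxx// (ltn_trans r0).
have tE : binw n a r = 'C(n, r)%:R * Kconst a ^+ n.
  by rewrite (Kconst_expr a01 nar) ?(ltnW rn)// /binw mulrA.
have t1 : binw n a r <= 1 by rewrite binw_le1 ?(ltW a0) ?(ltW a1)// ltnW.
have t8 : 1 <= 8 * n%:R * binw n a r.
  rewrite (le_trans (binw_mode_lb nar rn _)) ?(ltW a0)//.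
  rewrite ler_wpM2r ?binw_ge0 ?(ltW a0) ?(ltW a1)// ler_wpM2l//.
  rewrite -[leRHS]ger0_norm// -sqrtr_sqr ler_wsqrtr// expr2 ler_peMl//.
  by rewrite ler1n (ltn_trans r0).
have P0 : 0 < Kconst a ^+ n * cmod (1 + z) ^+ n by rewrite mulr_gt0 ?exprn_gt0.
have Z0 : 0 < cmod z ^+ r by rewrite exprn_gt0.
have hup : Kconst a ^+ n * cmod (1 + z) ^+ n <= n%:R * cmod z ^+ r.
  apply: (@le_trans _ _ (Kconst a ^+ n * (n%:R * ('C(n, r)%:R * cmod z ^+ r)))).
    by rewrite ler_wpM2l ?exprn_ge0 ?(ltW K0).
  have -> : Kconst a ^+ n * (n%:R * ('C(n, r)%:R * cmod z ^+ r)) =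
    binw n a r * (n%:R * cmod z ^+ r) by rewrite tE; ring.
  by rewrite ler_piMl// mulr_ge0// exprn_ge0// ltW.
(* The losses [2 n^3] from the size bound and [8 n] from the modal weight multiply to
   [16 n^4 <= n^5]; hence the condition [16 <= n] and the constant 5. *)
have hlo : cmod z ^+ r <= n%:R ^+ 5 * (Kconst a ^+ n * cmod (1 + z) ^+ n).
  apply: (@le_trans _ _ (n%:R ^+ 5 * (Kconst a ^+ n *
      ('C(n, r)%:R * cmod z ^+ r / (2 * n%:R ^+ 3))))); last first.
    by rewrite ler_wpM2l ?exprn_ge0 ?(ltW K0)// ler_wpM2l ?exprn_ge0 ?(ltW K0).
  have -> : n%:R ^+ 5 * (Kconst a ^+ n * ('C(n, r)%:R * cmod z ^+ r / (2 * n%:R ^+ 3)))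
    = (n%:R / 16 * (8 * n%:R * binw n a r)) * cmod z ^+ r.
    rewrite tE; move: (Kconst a ^+ n) (cmod z ^+ r) ('C(n, r)%:R) => k y c.
    have : n%:R != 0 :> R by rewrite gt_eqF.
    by move: (n%:R : R) => N N0; field.
  rewrite ler_peMl ?(ltW Z0)// mulr_ege1//.
  by rewrite ler_pdivlMr// mul1r ler_nat.
have lnZ : ln (cmod z ^+ r) = n%:R * (a * ln (cmod z)).
  by rewrite lnXn// mulrA nar mulr_natl.
have lnW : ln (Kconst a ^+ n * cmod (1 + z) ^+ n) =
    n%:R * (ln (cmod (1 + z)) + ln (Kconst a)).
  by rewrite lnM ?posrE ?exprn_gt0// !lnXn// mulrDr !mulr_natl addrC.
have ln0 : 0 <= ln n%:R :> R by rewrite ln_ge0// ler1n (ltn_trans r0).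
rewrite -(ler_pM2l n0) -[n%:R * `|_|]ger0_norm ?mulr_ge0// normrM normr_id -normrM.
have -> : n%:R * (5 * (ln n%:R / n%:R)) = 5 * ln n%:R :> R.
  by field; rewrite gt_eqF.
have -> : n%:R * logdefect a z =
    ln (cmod z ^+ r) - ln (Kconst a ^+ n * cmod (1 + z) ^+ n).
  by rewrite lnZ lnW /logdefect; ring.
have {}hup : ln (Kconst a ^+ n * cmod (1 + z) ^+ n) <= ln n%:R + ln (cmod z ^+ r).
  by rewrite -lnM ?posrE// ler_ln ?posrE// mulr_gt0.
have {}hlo : ln (cmod z ^+ r) <= 5 * ln n%:R + ln (Kconst a ^+ n * cmod (1 + z) ^+ n).
  rewrite [5 * _]mulr_natl -lnXn// -lnM ?posrE ?exprn_gt0//.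
  by rewrite ler_ln ?posrE// mulr_gt0 ?exprn_gt0.
by rewrite ler_norml; apply/andP; split; lra.
Qed.

End Truncation.

(** * The log defect and the limit curve *)

Section Curve.
Context {R : realType}.
Implicit Types (z w h p : R[i]) (a x : R).

Lemma ln_le_subr1 x : 0 < x -> ln x <= x - 1.
Proof. by move=> x0; have := @le_ln1Dx R (x - 1); rewrite (addrC 1) subrK; apply; lra. Qed.

Lemma ln_cmod w : w != 0 -> ln (cmod w) = ln (cmod w ^+ 2) / 2.
Proof. by move=> w0; rewrite lnXn ?cmod_gt0// -[_ *+ 2]mulr_natl mulrAC divff// mul1r. Qed.

(** The left logarithm is half of [ln (1 + X)] with [X = 2 Re w + |w|^2]. The lower bound on it
    comes from [ln y <= y - 1] at [y = (1 + X)^-1], and [X^2 <= 9 |w|^2]. *)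
Lemma ln_cmod1D w : cmod w <= 8^-1 -> 
  `|ln (cmod (1 + w)) - Re w| <= 9 * cmod w ^+ 2.
Proof.
move=> w8; have w0 := cmod_ge0 w; have := ler_Re_cmod w; rewrite ler_norml => /andP[r1 r2].
have w1 : 1 + w != 0.
  by rewrite -cmod_gt0; have := ler_cmodB 1 (- w); rewrite opprK cmodN cmod1; lra.
rewrite ln_cmod// sqr_cmod1D -addrA.
set X := 2 * Re w + cmod w ^+ 2.
have w2 : cmod w ^+ 2 <= 8^-1 * cmod w by rewrite expr2 ler_wpM2r.
have w20 : 0 <= cmod w ^+ 2 by rewrite sqr_ge0.
have X1 : - (2^-1) <= X by rewrite /X; lra.
have X2 : X ^+ 2 <= 9 * cmod w ^+ 2.
  have -> : 9 * cmod w ^+ 2 = (3 * cmod w) ^+ 2 by rewrite exprMn; ring.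
  rewrite -[leLHS]real_normK ?num_real// lerXn2r ?nnegrE ?normr_ge0//; first by lra.
  by rewrite ler_norml /X; apply/andP; split; lra.
have up : ln (1 + X) <= X by rewrite le_ln1Dx//; lra.
have X0 : 0 < 1 + X by lra.
have lo : X - 2 * X ^+ 2 <= ln (1 + X).
  have := @ln_le_subr1 (1 + X)^-1; rewrite invr_gt0 lnV ?posrE// => /(_ X0) h.
  suff : (1 + X)^-1 <= 1 - X + 2 * X ^+ 2 by lra.
  rewrite -[leLHS]mul1r ler_pdivrMr//.
  have -> : (1 - X + 2 * X ^+ 2) * (1 + X) = 1 + (X ^+ 2) * (1 + 2 * X) by ring.
  by rewrite lerDl mulr_ge0 ?sqr_ge0//; lra.
by rewrite ler_norml /X in up lo X2 *; apply/andP; split; lra.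
Qed.

(** The defect is the real part of [a log z - log (1 + z)] up to a constant, and the factor of [h]
    is the complex derivative. Factoring [z + h = z (1 + h/z)], and likewise for [1 + z], each
    logarithm costs [9 |h|^2 / m^2]. *)
Lemma logdefect_taylor a z h (m : R) : 0 <= a <= 1 -> 0 < m ->
  m <= cmod z -> m <= cmod (1 + z) -> cmod h <= m / 8 ->
  `|logdefect a (z + h) - logdefect a z - Re (h * (a%:C%C / z - (1 + z)^-1))|
  <= 18 / m ^+ 2 * cmod h ^+ 2.
Proof.
move=> /andP[a0 a1] m0 mz mz1 hm.
have z0 : z != 0 by rewrite -cmod_gt0 (lt_le_trans m0).
have z1 : 1 + z != 0 by rewrite -cmod_gt0 (lt_le_trans m0).
have small u : m <= cmod u -> cmod (h / u) <= cmod h / m.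
  by move=> mu; rewrite cmodM cmodV ler_wpM2l ?cmod_ge0//
    lef_pV2 ?posrE ?(lt_le_trans m0 mu).
have small8 u : m <= cmod u -> cmod (h / u) <= 8^-1.
  by move=> mu; rewrite (le_trans (small _ mu))// ler_pdivrMr// mulrC.
have lnD u : u != 0 -> m <= cmod u ->
    ln (cmod (u + h)) = ln (cmod u) + ln (cmod (1 + h / u)).
  move=> u0 mu; have -> : u + h = u * (1 + h / u) by field.
  rewrite cmodM lnM// posrE cmod_gt0// -cmod_gt0.
  have := ler_cmodB 1 (- (h / u)); rewrite opprK cmodN cmod1.
  by have := small8 _ mu; lra.
have e1 := ln_cmod1D (small8 _ mz).
have e2 := ln_cmod1D (small8 _ mz1).
rewrite /logdefect addrA !lnD//.
have sq u : m <= cmod u -> cmod (h / u) ^+ 2 <= (m ^+ 2)^-1 * cmod h ^+ 2.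
  move=> mu; rewrite -exprVn [leRHS]mulrC -exprMn.
  have mi : 0 <= m^-1 by rewrite invr_ge0 ltW.
  by rewrite lerXn2r ?small// nnegrE ?mulr_ge0 ?cmod_ge0.
have := sq _ mz; have := sq _ mz1.
have -> : Re (h * (a%:C%C / z - (1 + z)^-1)) = a * Re (h / z) - Re (h / (1 + z)).
  by rewrite -ReRM -ReN -ReD; congr Re; ring.
rewrite -[18 / _ * _]mulrA.
set Q := _^-1 * _; set L1 := ln (cmod (1 + h / z)); set L2 := ln (cmod (1 + _)).
set D1 := Re (h / z); set D2 := Re _ => s2 s1.
have -> : a * (ln (cmod z) + L1) - (ln (cmod (1 + z)) + L2) - ln (Kconst a) -
  (a * ln (cmod z) - ln (cmod (1 + z)) - ln (Kconst a)) - (a * D1 - D2) =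
  a * (L1 - D1) - (L2 - D2) by ring.
apply: le_trans (ler_normB _ _) _; rewrite normrM ger0_norm//.
have : a * `|L1 - D1| <= `|L1 - D1| by rewrite ler_piMl.
by rewrite -/L1 -/L2 -/D1 -/D2 in e1 e2; lra.
Qed.

(** The factored form shows that the branch point [a/(1-a)] is the only critical point and that the
    gradient is proportional to the distance from it. *)
Lemma logdefect_deriv a z : a != 1 -> z != 0 -> 1 + z != 0 ->
  a%:C%C / z - (1 + z)^-1 =
  (1 - a)%:C%C * ((a / (1 - a))%:C%C - z) / (z * (1 + z)).
Proof.
move=> a1 z0 z1.
have a1' : (1 - a)%:C%C != 0 :> R[i].
  by rewrite -cmod_gt0 cmodR normr_gt0 subr_eq0 eq_sym.
rewrite rmorphM fmorphV mulrBr mulrCA divff// mulr1 rmorphB rmorph1.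
by field; rewrite z1.
Qed.

Lemma ln_Kconst a : 0 < a < 1 ->
  ln (Kconst a) = a * ln (a / (1 - a)) - ln (1 + a / (1 - a)).
Proof.
move=> /andP[a0 a1]; have b0 : 0 < 1 - a by rewrite subr_gt0.
rewrite /Kconst lnM ?posrE ?powR_gt0// !ln_powR ln_div ?posrE//.
have -> : 1 + a / (1 - a) = (1 - a)^-1 by field; rewrite gt_eqF.
by rewrite lnV ?posrE//; ring.
Qed.

(** On this circle [ln_Kconst] reduces the defect to [ln ((1 + |p|) / |1 + p|)]. Then
    [- ln y >= 1 - y] is applied to the squared quotient, together with [|p - |p||^2 = |p| ((1 +
    |p|)^2 - |1 + p|^2)]. *)
Lemma logdefect_circle a p : 0 < a < 1 -> 1 + p != 0 ->
  cmod p = a / (1 - a) ->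
  cmod (p - (a / (1 - a))%:C%C) ^+ 2 / (2 * (cmod p * (1 + cmod p) ^+ 2)) <=
  logdefect a p.
Proof.
move=> a01 p1 pa; rewrite /logdefect ln_Kconst// -pa.
have p0 : 0 < cmod p by rewrite pa; case/andP: a01 => a0 a1; rewrite divr_gt0 ?subr_gt0.
have e1 := sqr_cmod1D p; have e2 := sqr_cmod p.
have e3 := sqr_cmod (p - (cmod p)%:C%C).
rewrite ReD ImD !(ReN, ImN) /= subr0 in e3.
have P2 : 0 < 1 + cmod p by rewrite addr_gt0.
have P1 : 0 < (1 + cmod p) ^+ 2 by rewrite exprn_gt0.
have c1 : 0 < cmod (1 + p) by rewrite cmod_gt0.
have h : cmod (p - (cmod p)%:C%C) ^+ 2 / (cmod p * (1 + cmod p) ^+ 2) =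
    1 - cmod (1 + p) ^+ 2 / (1 + cmod p) ^+ 2.
  have -> : cmod (p - (cmod p)%:C%C) ^+ 2 =
      cmod p * ((1 + cmod p) ^+ 2 - cmod (1 + p) ^+ 2).
    rewrite e3 e1.
    transitivity ((Re p ^+ 2 + Im p ^+ 2) - 2 * cmod p * Re p + cmod p ^+ 2); first ring.
    by rewrite -e2; ring.
  by field; rewrite !gt_eqF// addr_gt0.
have l := @ln_le_subr1 (cmod (1 + p) ^+ 2 / (1 + cmod p) ^+ 2).
have {}l := l (divr_gt0 (exprn_gt0 _ c1) P1).
rewrite ln_div ?posrE ?exprn_gt0// lnXn// lnXn// in l.
rewrite invfM mulrCA mulrC h.
set X := _ / _ in l *; rewrite !mulr2n in l.
by lra.
Qed.

(** Near [z = 0] the modulus of [1 + z] is at least 1/2, so a defect bounded below keeps [a ln |z|]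
    bounded below. Once [|z|] is bounded below, the upper bound on the defect does the same for
    [|1 + z|]. *)
Lemma logdefect_bounded_below (delta : R) : 0 < delta -> exists2 m : R, 0 < m <= 2^-1 &
  forall a z, delta < a < 1 - delta -> z != 0 -> 1 + z != 0 ->
  `|logdefect a z| <= 5 -> m <= cmod z /\ m <= cmod (1 + z).
Proof.
move=> d0; pose lk : R := ln (delta ^+ 2) - ln 2 - 5.
pose m0 := expR (- `|lk| / delta) / 2.
have m0gt : 0 < m0 by rewrite divr_gt0// expR_gt0.
have m0le : m0 <= 2^-1.
  rewrite /m0 ler_piMl// -[leRHS]expR0 ler_expR mulNr oppr_le0 divr_ge0 ?(ltW d0)//.

have e5 : expR (- 5) <= 1 :> R by rewrite -[leRHS]expR0 ler_expR; lra.
exists (m0 * expR (- 5)).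
  by rewrite mulr_gt0 ?expR_gt0//= (le_trans _ m0le)// ler_piMr// ltW.
move=> a z /andP[da a1] z0 z1; rewrite ler_norml /logdefect => /andP[lo up].
have a01 : 0 < a < 1 by apply/andP; split; lra.
have K0 := Kconst_gt0 a01.
have K1 : delta ^+ 2 <= Kconst a.
  rewrite /Kconst expr2; apply: ler_pM; rewrite ?(ltW d0)//.
    apply: le_trans (_ : a <= _); first by lra.
    by rewrite ger1_powR//; lra.
  apply: le_trans (_ : 1 - a <= _); first by lra.
  by rewrite ger1_powR//; lra.
have K2 : Kconst a <= 1.
  have pw y : 0 <= y <= 1 -> y `^ y <= 1.
    move=> /andP[y0 y1]; 
    have := ge0_ler_powR y0 (_ : y \in Num.nneg) (_ : 1 \in Num.nneg) y1.
    by rewrite powR1 !nnegrE => ->.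
  by rewrite /Kconst mulr_ile1 ?powR_ge0// pw//; lra.
have lK1 : ln (delta ^+ 2) <= ln (Kconst a).
  by rewrite ler_ln ?posrE ?exprn_gt0.
have lK2 : ln (Kconst a) <= 0 by rewrite ln_le0.
have c0 : 0 < cmod z by rewrite cmod_gt0.
have c1 : 0 < cmod (1 + z) by rewrite cmod_gt0.
have zm : m0 <= cmod z.
  have [zh|zh] := leP 2^-1 (cmod z); first exact: le_trans m0le zh.
  have w2 : 2^-1 <= cmod (1 + z).
    by have := ler_cmodB 1 (- z); rewrite cmod1 cmodN opprK; lra.
  have lw : - ln 2 <= ln (cmod (1 + z)).
    by rewrite -lnV ?posrE// ler_ln ?posrE.
  have alk : - `|lk| <= a * ln (cmod z).
    by rewrite (@le_trans _ _ lk) ?lerNnormlW// /lk; lra.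
  have lz : - `|lk| / delta <= ln (cmod z).
    rewrite ler_pdivrMr// (le_trans alk)// mulrC.
    have lz0 : ln (cmod z) <= 0 by rewrite ln_le0//; lra.
    by rewrite ler_wnM2l// ltW.
  rewrite /m0 ler_pdivrMr// (@le_trans _ _ (cmod z))//; last by lra.
  by rewrite -(lnK (_ : cmod z \is Num.pos)) ?posrE// ler_expR.
split; first by rewrite (le_trans _ zm)// ler_piMr// ltW.
rewrite -(lnK (_ : cmod (1 + z) \is Num.pos)) ?posrE//.
rewrite -(lnK (_ : m0 \is Num.pos)) ?posrE// -expRD ler_expR.
have lm : ln m0 <= ln (cmod z) by rewrite ler_ln ?posrE.
have lm0 : ln m0 <= 0 by rewrite ln_le0//; lra.
have am : a * ln m0 <= a * ln (cmod z) by rewrite ler_wpM2l//; lra.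
have am0 : 0 <= (a - 1) * ln m0 by rewrite mulr_le0//; lra.
by lra.
Qed.

Lemma continuous_cmod_pair w : continuous (fun p : R * R => cmod (w + Complex p.1 p.2)).
Proof.
case: w => u v p.
apply: (@continuous_comp _ _ _ (fun p : R * R => (u + p.1) ^+ 2 + (v + p.2) ^+ 2) Num.sqrt).
  by apply: cvgD; apply: cvgM; apply: cvgD; try exact: cvg_cst;
    [exact: cvg_fst|exact: cvg_fst|exact: cvg_snd|exact: cvg_snd].
exact: sqrt_continuous.
Qed.

Lemma continuous_cmod_line w h : continuous (fun t : R => cmod (w + t%:C%C * h)).
Proof.
move=> t.
have -> : (fun t : R => cmod (w + t%:C%C * h)) =
    (fun p : R * R => cmod (w + Complex p.1 p.2)) \o (fun t => (t * Re h, t * Im h)).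
  apply/funext => s /=; congr (cmod (w + _)).
  by apply/eqP; rewrite eq_complex ReRM ImRM /= !eqxx.
apply: continuous_comp; last exact: continuous_cmod_pair.
have lin (u : R) : (s * u @[s --> t] --> t * u).
  by apply: cvgM; [exact: cvg_id|exact: cvg_cst].
exact: (@cvg_pair _ _ _ _ (nbhs (t * Re h)) (nbhs (t * Im h)) _ _ _ _ _ (lin _) (lin _)).
Qed.
End Curve.

(** * From a small defect to a nearby point of the curve *)

Section Nearby.
Context {R : realType}.
Implicit Types (z w h p : R[i]) (a x : R).

Lemma continuous_logdefect_line a z h t :
  z + t%:C%C * h != 0 -> 1 + (z + t%:C%C * h) != 0 ->
  {for t, continuous (fun t : R => logdefect a (z + t%:C%C * h))}.
Proof.
move=> z0 z1; have cln (w : R[i]) : w + t%:C%C * h != 0 ->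
    (ln (cmod (w + s%:C%C * h)) @[s --> t] --> ln (cmod (w + t%:C%C * h))).
  move=> w0; apply: continuous_cvg; last exact: continuous_cmod_line.
  by apply: continuous_ln; rewrite cmod_gt0.
rewrite /continuous_at /logdefect; apply: cvgB; last exact: cvg_cst.
apply: cvgB; first by apply: cvgM; [exact: cvg_cst|exact: cln].
under eq_fun do rewrite addrA.
by rewrite addrA; apply: cln; rewrite -addrA.
Qed.

Lemma CcurveP a z : 0 < a < 1 -> Ccurve a z <->
  [/\ z != 0, 1 + z != 0, cmod z <= a / (1 - a) & logdefect a z = 0].
Proof.
move=> a01; have K0 := Kconst_gt0 a01; have /andP[a0 a1] := a01.
split => [[e zx]|[z0 z1 zx e]].
  have z0 : z != 0.
    apply/eqP => z0; move: e K0; rewrite z0 cmod0 powR0 ?gt_eqF// mul0r => <-.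
    by rewrite ltxx.
  have z1 : 1 + z != 0.
    apply/eqP => z1; move: e K0; rewrite z1 cmod0 invr0 mulr0 => <-.
    by rewrite ltxx.
  split=> //; rewrite /logdefect -e ln_div ?posrE ?powR_gt0 ?cmod_gt0// ln_powR.
  by rewrite subrr.
split=> //; apply: (@ln_inj R); rewrite ?posrE ?divr_gt0 ?powR_gt0 ?cmod_gt0//.
rewrite ln_div ?posrE ?powR_gt0 ?cmod_gt0// ln_powR.
by apply/eqP; rewrite -subr_eq0 -/(logdefect a z) e.
Qed.

Lemma Ccurve_zpoint a : 0 < a < 1 -> Ccurve a ((a / (1 - a))%:C%C : R[i]).
Proof.
move=> a01; apply/CcurveP => //; have /andP[a0 a1] := a01.
have x0 : 0 < a / (1 - a) by rewrite divr_gt0// subr_gt0.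
have e : 1 + (a / (1 - a))%:C%C = (1 + a / (1 - a))%:C%C :> R[i].
  by rewrite rmorphD rmorph1.
have c1 : cmod ((a / (1 - a))%:C%C : R[i]) = a / (1 - a).
  by rewrite cmodR gtr0_norm.
have c2 : cmod (1 + (a / (1 - a))%:C%C : R[i]) = 1 + a / (1 - a).
  by rewrite e cmodR gtr0_norm// addr_gt0.
split; rewrite -?cmod_gt0 ?c1 ?c2// ?addr_gt0//.
by rewrite /logdefect ln_Kconst// c1 c2; ring.
Qed.

(* Away from the branch point, follow the gradient of the log defect; its
   modulus is comparable to the distance [D] from [z] to the branch point, so
   the defect is corrected within [O(eps / D)]. On the circle [|p| = a/(1-a)]
   the defect is at least of order [D^2], so this path stays in the disc. If
   [D^2 = O(eps)], the branch point itself, which lies on the curve, is close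
   enough. *)
Lemma near_Ccurve (delta : R) : 0 < delta -> exists c : R,
  forall a z (eps : R), delta < a < 1 - delta -> z != 0 -> 1 + z != 0 ->
  cmod z <= a / (1 - a) -> 0 <= eps <= 5 -> `|logdefect a z| <= eps ->
  exists2 zeta, Ccurve a zeta &
    cmod (z - zeta) * cmod (z - (a / (1 - a))%:C%C) <= c * eps.
Proof.
move=> d0; have [m /andP[m0 m2] mP] := logdefect_bounded_below d0.
(* [M] is the Taylor constant, and the gradient lies between [g D] and [F D]; [T] makes a step
   [t0 = T eps / D] change the linear part by at least [2 eps]. If [D^2 > A eps], the four summands
   of [A] give in turn [M t0^2 <= eps], [t0 <= D/2], [t0 <= m/16], and the contradiction on the
   circle. *)
pose M := 18 / (m / 2) ^+ 2; pose F := m ^- 2; pose g := delta ^+ 3 / 2; pose T := 2 / g.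
have M0 : 0 < M by rewrite divr_gt0// exprn_gt0// divr_gt0.
have F0 : 0 < F by rewrite invr_gt0 exprn_gt0.
have g0 : 0 < g by rewrite divr_gt0// exprn_gt0.
have T0 : 0 < T by rewrite divr_gt0.
pose A1 := M * T ^+ 2; pose A3 := 5 * (16 * T / m) ^+ 2.
pose A4 := 32 * (2 + T * F) / delta ^+ 3.
have A10 : 0 < A1 by rewrite mulr_gt0// exprn_gt0.
have A30 : 0 < A3 by rewrite mulr_gt0// exprn_gt0// divr_gt0// mulr_gt0.
have A40 : 0 < A4 by rewrite divr_gt0 ?exprn_gt0// mulr_gt0// addr_gt0// mulr_gt0.
pose A := A1 + 2 * T + A3 + A4; exists A => a z eps da z0 z1 zx /andP[e0 e5] le.
have /andP[da1 da2] := da.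
have a01 : 0 < a < 1 by apply/andP; split; lra.
have /andP[a0 a1] := a01.
have [mz mz1] : m <= cmod z /\ m <= cmod (1 + z).
  by apply: (mP a) => //; apply: le_trans e5.
set x := a / (1 - a) in zx *; set D := cmod (z - x%:C%C).
have b0 : 0 < 1 - a by lra.
have x0 : 0 < x by rewrite divr_gt0.
have D0 : 0 <= D by apply: cmod_ge0.
have [DA|DA] := leP (D ^+ 2) (A * eps).
  exists x%:C%C; first exact: Ccurve_zpoint.
  by rewrite -/D -expr2.
have Ae0 : 0 <= A * eps by rewrite mulr_ge0// /A; lra.
have {}D0 : 0 < D.
  rewrite lt_neqAle D0 andbT eq_sym; apply/eqP => DE.
  by move: DA; rewrite DE expr0n ltNge Ae0.
pose t0 := T * eps / D.
have t00 : 0 <= t0.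
  apply: divr_ge0; last exact: ltW.
  by apply: mulr_ge0 => //; exact: ltW.
have AE (B : R) : B <= A -> B * eps < D ^+ 2.
  by move=> BA; apply: le_lt_trans DA; rewrite ler_wpM2r.
have t0D : t0 <= D / 2.
  rewrite ler_pdivrMr// [leRHS]mulrAC -expr2.
  have : 2 * T * eps < D ^+ 2 by apply: AE; rewrite /A; lra.
  by lra.
have t0sq : t0 ^+ 2 * D ^+ 2 = T ^+ 2 * eps * eps.
  by rewrite /t0 exprMn exprVn divfK ?expf_neq0 ?gt_eqF//; ring.
have D20 : 0 < D ^+ 2 by rewrite exprn_gt0.
have Mt0 : M * t0 ^+ 2 <= eps.
  rewrite -(ler_pM2r D20) -mulrA t0sq.
  have h : A1 * eps <= D ^+ 2 by apply: ltW; apply: AE; rewrite /A; lra.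
  have -> : M * (T ^+ 2 * eps * eps) = eps * (A1 * eps) by rewrite /A1; ring.
  by rewrite ler_wpM2l.
have t0m : t0 <= m / 16.
  have m16 : 0 <= m / 16 by rewrite divr_ge0// ltW.
  rewrite -(@ler_pXn2r _ 2) ?nnegrE// -(ler_pM2r D20) t0sq.
  have h : A3 * eps <= D ^+ 2 by apply: ltW; apply: AE; rewrite /A; lra.
  apply: (@le_trans _ _ ((m / 16) ^+ 2 * (A3 * eps))); last first.
    by rewrite ler_wpM2l ?sqr_ge0.
  have -> : (m / 16) ^+ 2 * (A3 * eps) = T ^+ 2 * eps * 5.
    by rewrite /A3; field; rewrite gt_eqF.
  by rewrite ler_wpM2l// mulr_ge0// sqr_ge0.
have t0m' : t0 <= m / 2 by lra.
have A4e : 32 * (2 + T * F) * eps / delta ^+ 3 < D ^+ 2.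
  have -> : 32 * (2 + T * F) * eps / delta ^+ 3 = A4 * eps by rewrite /A4 mulrAC.
  by apply: AE; rewrite /A; lra.
have TA : T * eps <= A * eps by rewrite ler_wpM2r// /A; lra.
have /andP[lez1 lez2] : - eps <= logdefect a z <= eps by rewrite -ler_norml.
clear AE DA Ae0 t0sq A10 A30 A40 mP le.
pose f := a%:C%C / z - (1 + z)^-1.
have fE : cmod f = (1 - a) * D / (cmod z * cmod (1 + z)).
  rewrite /f logdefect_deriv ?(lt_eqF a1)// cmodM cmodV !cmodM cmodR gtr0_norm//.
  by rewrite -/x cmodC.
have c0 : 0 < cmod z * cmod (1 + z) by rewrite mulr_gt0 ?cmod_gt0.
have x1 : x <= delta^-1.
  by rewrite /x -[leRHS]mul1r ler_pM ?invr_ge0 ?(ltW a0) ?(ltW a1) ?(ltW b0)//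
    lef_pV2 ?posrE//; lra.
have x2 : 1 + x <= delta^-1.
  have -> : 1 + x = (1 - a)^-1 by rewrite /x; field; rewrite gt_eqF.
  by rewrite lef_pV2 ?posrE//; lra.
have di0 : 0 < delta^-1 by rewrite invr_gt0.
have fg : g * D <= cmod f.
  rewrite fE ler_pdivlMr// mulrAC ler_wpM2r ?(ltW D0)//.
  apply: (@le_trans _ _ delta); last lra.
  have -> : delta = g * (delta^-1 * (2 * delta^-1)).
    by rewrite /g; field; rewrite gt_eqF.
  rewrite ler_wpM2l ?(ltW g0)//; apply: ler_pM; rewrite ?cmod_ge0 ?(le_trans zx)//.
  by apply: le_trans (ler_cmodD _ _) _; rewrite cmod1; lra.
have fF : cmod f <= F * D.
  rewrite fE mulrAC ler_wpM2r ?(ltW D0)// ler_pdivrMr//.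
  apply: (@le_trans _ _ 1); first lra.
  have -> : 1 = F * (m * m) by rewrite /F; field; rewrite gt_eqF.
  by rewrite ler_wpM2l ?(ltW F0)//; apply: ler_pM; rewrite ?(ltW m0).
have f0 : 0 < cmod f by rewrite (lt_le_trans _ fg)// mulr_gt0.
(* The unit vector along the gradient: [e * f] is the positive real [cmod f]. *)
pose e : R[i] := (conjc f) / (cmod f)%:C%C.
have ce : cmod e = 1.
  by rewrite /e cmodM cmodV cmodJ cmodR gtr0_norm// divff// gt_eqF.
have fe : e * f = (cmod f)%:C%C.
  by rewrite /e mulrAC mulcJ expr2 mulfK// -cmod_eq0 cmodR normr_eq0 gt_eqF.
pose phi t := logdefect a (z + t%:C%C * e).
have far t : `|t| <= t0 -> z + t%:C%C * e != 0 /\ 1 + (z + t%:C%C * e) != 0.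
  move=> tt; have te : cmod (t%:C%C * e) <= m / 2.
    by rewrite cmodM ce mulr1 cmodR (le_trans tt).
  have gt0 w : m <= cmod w -> w + t%:C%C * e != 0.
    move=> mw; rewrite -cmod_gt0 -[_ * e]opprK.
    by apply: lt_le_trans (ler_cmodB _ _); rewrite cmodN; lra.
  by split; [apply: gt0|rewrite addrA; apply: gt0].
have phiT t : `|t| <= t0 ->
    `|phi t - logdefect a z - t * cmod f| <= eps.
  move=> tt; have := @logdefect_taylor R a z (t%:C%C * e) (m / 2).
  rewrite -/(phi t) -/f -[_ * e * f]mulrA fe -rmorphM/= cmodM ce cmodR mulr1 => h.
  apply: (le_trans (h _ _ _ _ _)); rewrite ?divr_gt0 ?(ltW a0) ?(ltW a1)//; try lra.
  rewrite (le_trans _ Mt0)// ler_wpM2l ?(ltW M0)//.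
  by rewrite lerXn2r ?nnegrE.
have t0f : 2 * eps <= t0 * cmod f.
  have -> : 2 * eps = t0 * (g * D) by rewrite /t0 /T; field; rewrite !gt_eqF.
  by rewrite ler_wpM2l.
(* At the ends the linear part, at least [2 eps] in size, outweighs the initial defect and the
   Taylor remainder, each at most [eps]; so [phi] changes sign. *)
have [t tt pt] : exists2 t, t \in `[- t0, t0] & phi t = 0.
  apply: IVT; first lra.
    apply: continuous_in_subspaceT => t; rewrite inE /= in_itv /= -ler_norml => tt.
    by have [n0 n1] := far _ tt; exact: continuous_logdefect_line.
  have h1 := phiT t0; have h2 := phiT (- t0).
  rewrite normrN ger0_norm// in h1 h2.
  have := h1 (lexx _); have := h2 (lexx _); rewrite !ler_norml => /andP[u1 u2] /andP[v1 v2].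
  have p1 : phi (- t0) <= 0 by lra.
  have p2 : 0 <= phi t0 by lra.
  by rewrite ge_min p1 le_max p2 orbT.
rewrite in_itv /= -ler_norml in tt.
have [n0 n1] := far _ tt.
exists (z + t%:C%C * e); last first.
  rewrite opprD addrA subrr sub0r cmodN cmodM ce mulr1 cmodR -/D.
  apply: (@le_trans _ _ (t0 * D)); first by rewrite ler_wpM2r// ltW.
  by rewrite /t0 divfK ?gt_eqF.
apply/CcurveP => //; split => //; rewrite leNgt; apply/negP => zetax.
(* A path leaving the disc crosses the circle, still at distance at least [D/2] from the branch
   point. There the defect is at least [D^2 delta^3 / 8] but at most [(2 + T F) eps], against the
   choice of [A4]. *)
have [s s01 sx] : exists2 s, s \in `[0, 1] & cmod (z + s%:C%C * (t%:C%C * e)) = x.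
  apply: IVT; first exact: ler01.
    by apply: continuous_subspaceT; exact: continuous_cmod_line.
  by rewrite rmorph0 rmorph1 mul0r mul1r addr0 ge_min zx le_max (ltW zetax) orbT.
rewrite in_itv /= in s01; have /andP[s0 s1] := s01.
rewrite mulrA -rmorphM /= in sx.
have st : `|s * t| <= t0 by rewrite normrM ger0_norm// (le_trans _ tt)// ler_piMl.
have [_ p1] := far _ st.
have := logdefect_circle a01 p1 sx; rewrite -/(phi (s * t)) sx => hc.
have pD : D / 2 <= cmod (z + (s * t)%:C%C * e - x%:C%C).
  rewrite addrAC -[_ * e]opprK (le_trans _ (ler_cmodB _ _))// cmodN cmodM ce mulr1 cmodR.
  by rewrite -/D; lra.
have := phiT _ st; rewrite ler_norml => /andP[_ hu].
have stf : s * t * cmod f <= T * F * eps.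
  have -> : T * F * eps = t0 * (F * D) by rewrite /t0; field; rewrite gt_eqF.
  apply: (@le_trans _ _ (t0 * cmod f)); last by rewrite ler_wpM2l.
  by rewrite ler_wpM2r ?(ltW f0)// (le_trans (ler_norm _)).
have low : D ^+ 2 * delta ^+ 3 / 8 <= phi (s * t).
  apply: le_trans hc.
  have d30 : 0 < delta ^+ 3 by rewrite exprn_gt0.
  have -> : D ^+ 2 * delta ^+ 3 / 8 = (D / 2) ^+ 2 * (2 * (delta^-1 * delta^-1 ^+ 2))^-1.
    by field; rewrite gt_eqF.
  apply: ler_pM; rewrite ?sqr_ge0//.
    by rewrite invr_ge0 !mulr_ge0 ?exprn_ge0 ?(ltW di0).
    by rewrite lerXn2r ?nnegrE ?cmod_ge0// divr_ge0// ltW.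
  have x10 : 0 < 1 + x by rewrite addr_gt0.
  have xx0 : 0 < x * (1 + x) ^+ 2 by rewrite mulr_gt0// exprn_gt0.
  have dd0 : 0 < delta^-1 * delta^-1 ^+ 2 by rewrite mulr_gt0// exprn_gt0.
  rewrite lef_pV2 ?posrE ?(mulr_gt0 _ xx0) ?(mulr_gt0 _ dd0)// ler_wpM2l//.
  apply: ler_pM; rewrite ?(ltW x0) ?sqr_ge0//.
  by rewrite lerXn2r ?nnegrE ?(ltW x10) ?(ltW di0).
have d30 : 0 < delta ^+ 3 by rewrite exprn_gt0.
have TF0 : 0 <= (2 + T * F) * eps by rewrite mulr_ge0// addr_ge0// mulr_ge0// ltW.
rewrite ltr_pdivrMr// in A4e.
by lra.
Qed.
End Nearby.

(** * Attained distance to the curve, and the first estimate *)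

Section Part1.
Context {R : realType}.
Implicit Types (z w h : R[i]) (a x : R).

(** The curve is compact. To present it as a closed set, the logarithms are cut off below [m], which
    makes the defect continuous on the whole plane; [logdefect_bounded_below] shows that the cut-off
    never acts on the curve. *)
Lemma Ccurve_dist_min a w : 0 < a < 1 ->
  exists m : R, is_min [set cmod (w - zeta) | zeta in Ccurve a] m.
Proof.
move=> a01; have /andP[a0 a1] := a01; pose delta := Num.min a (1 - a) / 2.
have d0 : 0 < delta by rewrite divr_gt0// lt_min a0 subr_gt0.
have da : delta < a < 1 - delta.
  have h1 : Num.min a (1 - a) <= a by rewrite ge_min lexx.
  have h2 : Num.min a (1 - a) <= 1 - a by rewrite ge_min lexx orbT.
  by rewrite /delta; apply/andP; split; lra.
have [m /andP[m0 _] mP] := logdefect_bounded_below d0.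
pose f (u : R[i]) (p : R * R) := cmod (u + Complex p.1 p.2).
have cf u : continuous (f u) := @continuous_cmod_pair R u.
pose lnm u p := ln (Num.max m (f u p)).
have clnm u : continuous (lnm u).
  move=> p; apply: continuous_cvg.
    by apply: continuous_ln; rewrite lt_max m0.
  have cm : continuous (fun y : R => Num.max m y).
    by apply: max_fun_continuous => y; [exact: cvg_cst|exact: cvg_id].
  by apply: continuous_cvg; [exact: cm|exact: cf].
pose psi p := a * lnm 0 p - lnm 1 p - ln (Kconst a).
have cpsi : continuous psi.
  move=> p; apply: cvgB; last exact: cvg_cst.
  by apply: cvgB; [apply: cvgM; [exact: cvg_cst|exact: clnm]|exact: clnm].
pose A := (f 0 @^-1` [set y | m <= y]) `&` (f 1 @^-1` [set y | m <= y]) `&`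
  (f 0 @^-1` [set y | y <= a / (1 - a)]) `&` (psi @^-1` [set y | y = 0]).
have AP p : A p <-> Ccurve a (Complex p.1 p.2).
  split.
    move=> [[[h1 h2] h3] h4]; move: h1 h2 h3 h4.
    rewrite /psi /lnm /= /f add0r => h1 h2 h3.
    rewrite !max_r// => h4; apply/CcurveP => //; split=> //.
      by rewrite -cmod_gt0 (lt_le_trans m0).
    by rewrite -cmod_gt0 (lt_le_trans m0).
  move=> /CcurveP => /(_ a01)[h1 h2 h3 h4].
  have [m1 m2] : m <= cmod (Complex p.1 p.2) /\ m <= cmod (1 + Complex p.1 p.2).
    by apply: (mP a) => //; rewrite h4 normr0.
  split; [split; [split|]|]; rewrite /= ?/f ?add0r//.
  by rewrite /psi /lnm /f add0r !max_r.
have clA : closed A.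
  have cl g (D : set R) : continuous g -> closed D -> closed (g @^-1` D).
    by move=> cg cD; apply: preimage_closed cD => p _; exact: cg.
  by do ![apply: closedI]; apply: cl.
pose x := a / (1 - a).
have cA : compact A.
  have cx := @segment_compact R (- x) x.
  apply: (subclosed_compact clA (compact_setX cx cx)).
  move=> [u v] [[_ h] _].
  have hx : cmod (Complex u v) <= x by rewrite -[Complex u v]add0r; exact: h.
  split; rewrite /= in_itv /= -ler_norml; apply: le_trans hx.
    exact: (ler_Re_cmod (Complex u v)).
  exact: (ler_Im_cmod (Complex u v)).
have [] := compact_EVT_min (_ : A !=set0) cA (_ : {within A, continuous (f (- w))}).
- by exists (x, 0); apply/AP; exact: Ccurve_zpoint.
- by apply: continuous_subspaceT; exact: cf.
move=> [u v]; rewrite inE => /AP hp hmin; exists (cmod (w - Complex u v)); split.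
  by exists (Complex u v).
move=> _ [[u' v'] h' <-].
have := hmin (u', v'); rewrite inE => /(_ _)/=; rewrite /f /= -![- w + _]addrC => h.
by rewrite ![cmod (w - _)]cmodC; apply: h; apply/AP.
Qed.
Lemma zpointE r n : (r < n)%N ->
  zpoint R r n = (r%:R / n%:R / (1 - r%:R / n%:R))%:C%C.
Proof.
move=> rn; congr (_%:C%C).
have n0 : n%:R != 0 :> R by rewrite pnatr_eq0 -lt0n (leq_ltn_trans _ rn).
have nr : n%:R - r%:R != 0 :> R by rewrite subr_eq0 eqr_nat gtn_eqF.
by field; rewrite nr n0.
Qed.

Lemma binpoly_roots_near_Ccurve (delta : R) : 0 < delta ->
  exists (c : R) (N : nat), forall r n : nat,
     (1 <= r <= n)%N -> (N < r)%N -> (N < n)%N ->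
     delta < r%:R / n%:R < 1 - delta ->
     forall zs : R[i], root (binpoly R r n) zs ->
     exists m : R,
       is_min [set cmod (zs - zeta) | zeta in Ccurve (r%:R / n%:R)] m /\
       m <= c / cmod (zs - zpoint R r n) * (ln n%:R / n%:R).
Proof.
move=> d0; have [c cP] := near_Ccurve d0.
exists (c * 5), 16%N => r n /andP[r1 rn] Nr Nn da z Bz.
set a : R := r%:R / n%:R in da *.
have n0 : 0 < n%:R :> R by rewrite ltr0n (leq_ltn_trans _ Nn).
have a01 : 0 < a < 1 by have /andP[] := da; move=> *; apply/andP; split; lra.
have /andP[a0 a1] := a01.
have rn' : (r < n)%N by move: a1; rewrite ltr_pdivrMr// mul1r ltr_nat.
have rn'' : (0 < r < n)%N by rewrite r1.
have /andP[z1 z2] := root_binpoly_bounds rn'' Bz.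
have nr : 0 < n%:R - r%:R :> R by rewrite subr_gt0 ltr_nat.
have xE : a / (1 - a) = r%:R / (n%:R - r%:R).
  by rewrite /a; field; rewrite !gt_eqF.
(* Strictness keeps [z] away from the branch point, so the division by the distance in the
   conclusion is a genuine one. *)
have z3 : cmod z < a / (1 - a).
  rewrite xE (le_lt_trans z2)// ltr_pM2l ?ltr0n// ltf_pV2 ?posrE//; lra.
have z0 : z != 0 by rewrite -cmod_gt0 (lt_le_trans _ z1)// invr_gt0.
have w0 : 1 + z != 0.
  have /andP[+ _] := root_binpoly_size rn'' Bz.
  apply: contraTneq => ->; rewrite cmod0 expr0n gtn_eqF ?(leq_ltn_trans _ Nn)//.
  rewrite -ltNge divr_gt0 ?mulr_gt0 ?exprn_gt0 ?cmod_gt0// ltr0n bin_gt0.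
  exact: ltnW.
have le := root_binpoly_logdefect rn'' (ltnW Nn) Bz.
set e := 5 * _ in le; have e05 : 0 <= e <= 5.
  have l0 : 0 <= ln n%:R :> R by rewrite ln_ge0// ler1n (leq_ltn_trans _ Nn).
  have q0 : 0 <= ln n%:R / n%:R :> R by rewrite divr_ge0// ltW.
  have q1 : ln n%:R / n%:R <= 1 :> R.
    by rewrite ler_pdivrMr// mul1r ltW// ln_sublinear.
  by rewrite /e; apply/andP; split; lra.
have [zeta zC zd] := cP a z _ da z0 w0 (ltW z3) e05 le.
have [m mm] := Ccurve_dist_min z a01.
exists m; split=> //.
have mz : m <= cmod (z - zeta) by apply: (mm.2); exists zeta.
apply: le_trans mz _; rewrite (zpointE rn').
have D0 : 0 < cmod (z - (a / (1 - a))%:C%C).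
  rewrite cmod_gt0 subr_eq0; apply/eqP => zE; move: z3.
  by rewrite zE cmodR ger0_norm ?ltxx// divr_ge0// ltW// subr_gt0.
rewrite mulrAC ler_pdivlMr//.
by rewrite (le_trans zd)// mulrA.
Qed.
End Part1.

(** * Power sums and zero-free discs *)

Section LogSeries.
Context {R : realType}.
Implicit Types (a z w : R[i]) (x M : R).

Lemma cmod_1B_gt0 a : cmod a <= 2^-1 -> 0 < cmod (1 - a).
Proof. by move=> a2; have := ler_cmodB 1 a; rewrite cmod1; lra. Qed.

Lemma Re_div z w : Re (z / w) = (Re z * Re w + Im z * Im w) / cmod w ^+ 2.
Proof.
rewrite sqr_cmod; case: z w => u v [c d].
by rewrite /=; ring.
Qed.

(** Mean value theorem along [t a], [0 <= t <= 1], with [|1 - t a|^2] written as the real polynomial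
    [q]. The geometric sum collapses the derivative of the error to
    [- Re (a^(L+1) t^L / (1 - t a))], which is at most [2^-L]. *)
Lemma ln_cmod1B_series a L : cmod a <= 2^-1 ->
  `|ln (cmod (1 - a)) + \sum_(l < L) Re (a ^+ l.+1) / l.+1%:R| <= 2^-1 ^+ L.
Proof.
move=> a2; have ca := cmod_ge0 a.
pose q : {poly R} := 1 - (2 * Re a) *: 'X + (cmod a ^+ 2) *: 'X^2.
pose p : {poly R} := \sum_(l < L) (Re (a ^+ l.+1) / l.+1%:R) *: 'X^(l.+1).
have qE t : q.[t] = cmod (1 - t%:C%C * a) ^+ 2.
  have := sqr_cmod1D (- (t%:C%C * a)); rewrite ReN ReRM cmodN cmodM cmodR => ->.
  rewrite exprMn real_normK ?num_real// /q !hornerE /=. ring.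
have small t : 0 <= t <= 1 -> cmod (t%:C%C * a) <= 2^-1.
  by move=> /andP[t0 t1]; rewrite cmodM cmodR ger0_norm// (le_trans _ a2)// ler_piMl.
have q0 t : 0 <= t <= 1 -> 0 < q.[t].
  by move=> t01; rewrite qE exprn_gt0// cmod_1B_gt0// small.
have pE t : p.[t] = \sum_(l < L) Re (a ^+ l.+1) / l.+1%:R * t ^+ l.+1.
  by rewrite horner_sum; apply: eq_bigr => l _; rewrite !hornerE.
have dpE t : p^`().[t] = \sum_(l < L) Re (a ^+ l.+1) * t ^+ l.
  rewrite raddf_sum horner_sum; apply: eq_bigr => l _ /=.
  rewrite derivZ derivXn /= hornerZ hornerMn hornerXn -[t ^+ l *+ _]mulr_natl.
  by rewrite mulrA divfK// pnatr_eq0.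
pose f (t : R) := 2^-1 * ln q.[t] + p.[t].
pose df (t : R) := 2^-1 * (q.[t]^-1 * q^`().[t]) + p^`().[t].
have fd (t : R) : 0 <= t <= 1 -> is_derive t 1 f (df t).
  move=> t01.
  have h := is_derive1_comp (is_derive1_ln (q0 t t01)) (is_derive_poly q t).
  exact: is_deriveD (is_deriveZ 2^-1 h) (is_derive_poly p t).
have dfE (t : R) : 0 <= t <= 1 ->
    df t = - Re (a ^+ L.+1 * t%:C%C ^+ L / (1 - t%:C%C * a)).
  move=> t01; have n0 := cmod_1B_gt0 (small t t01); rewrite cmod_gt0 in n0.
  rewrite /df.
  have -> : p^`().[t] = Re (a * (1 - (t%:C%C * a) ^+ L) / (1 - t%:C%C * a)).
    rewrite -[1 - _ ^+ L]opprB subrX1 -mulNr opprB mulrA mulrAC mulfK//.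
    rewrite dpE mulr_sumr Re_sum; apply: eq_bigr => l _.
    rewrite exprMn mulrCA -exprS mulrC -rmorphXn ReRM. done.
  have -> : 2^-1 * (q.[t]^-1 * q^`().[t]) = - Re (a / (1 - t%:C%C * a)).
    have -> : q^`().[t] = - (2 * Re a) + 2 * (cmod a ^+ 2 * t).
      by rewrite /q !poly.derivE !hornerE /=; ring.
    rewrite Re_div -qE.
    have -> : Re (1 - t%:C%C * a) = 1 - t * Re a by rewrite ReD ReN ReRM.
    have -> : Im (1 - t%:C%C * a) = - t * Im a by rewrite ImD ImN ImRM /= add0r mulNr.
    by rewrite sqr_cmod; field; rewrite gt_eqF// q0.
  rewrite -!ReN addrC -ReD; congr (Re _).
  by rewrite exprMn exprS; field.
have dfle t : 0 <= t <= 1 -> `|df t| <= 2^-1 ^+ L.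
  move=> t01; rewrite dfE// normrN (le_trans (ler_Re_cmod _))//.
  have [t0 t1] := andP t01.
  rewrite cmodM cmodV ler_pdivrMr; last by rewrite cmod_1B_gt0// small.
  rewrite cmodM !cmodX cmodR ger0_norm//.
  apply: (@le_trans _ _ (2^-1 ^+ L * 2^-1)).
    apply: (@le_trans _ _ (cmod a ^+ L.+1)).
      by rewrite ler_piMr ?exprn_ge0// exprn_ile1.
    by rewrite -exprSr lerXn2r ?nnegrE.
  rewrite ler_wpM2l ?exprn_ge0//.
  by have := ler_cmodB 1 (t%:C%C * a); rewrite cmod1; have := small t t01; lra.
have f1 : f 1 = ln (cmod (1 - a)) + \sum_(l < L) Re (a ^+ l.+1) / l.+1%:R.
  rewrite /f qE rmorph1 mul1r lnXn ?cmod_1B_gt0// pE; congr (_ + _).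
    by rewrite -[ln _ *+ 2]mulr_natl mulKf// pnatr_eq0.
  by apply: eq_bigr => l _; rewrite expr1n mulr1.
have f0 : f 0 = 0.
  rewrite /f qE rmorph0 mul0r subr0 cmod1 expr1n ln1 mulr0 add0r pE big1// => l _.
  by rewrite expr0n mulr0.
rewrite -f1 -[f 1]subr0 -f0.
have [|||c] := @MVT_segment R f df 0 1.
- exact: ler01.
- by move=> t; rewrite in_itv /= => /andP[t0 t1]; apply: fd; rewrite !ltW.
- apply: continuous_in_subspaceT => t; rewrite inE /= in_itv /= => t01.
  have ft := fd t t01; apply: differentiable_continuous.
  exact/derivable1_diffP/ex_derive.
rewrite in_itv /= => c01 ->; rewrite subr0 mulr1; exact: dfle.
Qed.

End LogSeries.

(** * Taylor coefficients from a one-sided bound *)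

Section PowerSums.
Context {R : realType}.
Implicit Types (a z w : R[i]) (x M : R).

Lemma complex_prim_root N : (0 < N)%N -> exists w : R[i], N.-primitive_root w.
Proof.
move=> N0; have [rs e] := closed_field_poly_normal ('X^N - 1 : {poly R[i]}).
rewrite (monicP (monicXnsubC _ N0)) scale1r in e.
have unit_rs : all N.-unity_root rs.
  by apply/allP => z zr; rewrite /root_of_unity e root_prod_XsubC.
have uniq_rs : uniq rs.
  rewrite -separable.separable_prod_XsubC -e cyclotomic.separable_Xn_sub_1//.
  by rewrite pnatr_eq0 -lt0n.
have size_rs : (N <= size rs)%N.
  by rewrite -ltnS -(size_prod_XsubC rs id) -e size_XnsubC.
by have /hasP[w _ ?] := cyclic.has_prim_root N0 unit_rs uniq_rs size_rs; exists w.
Qed.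

Lemma sum_prim_root N w e : N.-primitive_root w ->
  \sum_(i < N) (w ^+ i) ^+ e = if (N %| e)%N then N%:R else 0.
Proof.
move=> wN; under eq_bigr do rewrite -exprM mulnC exprM.
have := prim_order_dvd wN e; case: ifP => [_ /esym/eqP we|_ /esym we].
  by under eq_bigr do rewrite we expr1n; rewrite sumr_const card_ord.
have w1 : w ^+ e - 1 != 0 by rewrite subr_eq0 we.
apply: (mulfI w1).
by rewrite -subrX1 -exprM mulnC exprM (prim_expr_order wN) expr1n subrr mulr0.
Qed.

Lemma cmod_prim_root N w : (0 < N)%N -> N.-primitive_root w -> cmod w = 1.
Proof.
move=> N0 wN; apply/eqP; rewrite -(@pexpr_eq1 _ _ N)// ?cmod_ge0//.
by rewrite -cmodX (prim_expr_order wN) cmod1.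
Qed.

Lemma ReMRe z w : Re z * Re w = (Re (z * w) + Re (z * conjc w)) / 2.
Proof. by case: z w => u v [c d] /=; field. Qed.

Lemma conjc_unit_inv z : cmod z = 1 -> conjc z = z^-1.
Proof.
move=> z1; have z0 : z != 0 by rewrite -cmod_eq0 z1 oner_eq0.
by apply: (mulIf z0); rewrite mulVf// mulcJ z1 rmorph1 expr1n.
Qed.

(* Averaging over the [N]-th roots of unity against [1 + Re (zeta^k)] isolates
   the [k]-th Taylor coefficient. *)
Lemma sum_prim_root_weight N w (b : R[i]) (s : R) k l :
  N.-primitive_root w -> (0 < k)%N -> (0 < l)%N -> (k + l < N)%N ->
  \sum_(i < N) (1 + s * Re ((w ^+ i) ^+ k)) * Re (b * (w ^+ i) ^+ l) =
  if l == k then N%:R / 2 * s * Re b else 0.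
Proof.
move=> wN k0 l0 kl; have N0 : (0 < N)%N by lia.
have w1 : cmod w = 1 := cmod_prim_root N0 wN.
have sumRe (c : R[i]) e : \sum_(i < N) Re (c * (w ^+ i) ^+ e) =
    if (N %| e)%N then N%:R * Re c else 0.
  rewrite -Re_sum -mulr_sumr (sum_prim_root e wN); case: ifP => _.
    by rewrite mulrC -(rmorph_nat (real_complex R)) ReRM.
  by rewrite mulr0.
have term i : (1 + s * Re ((w ^+ i) ^+ k)) * Re (b * (w ^+ i) ^+ l) =
    Re (b * (w ^+ i) ^+ l) + s / 2 * Re (b * (w ^+ i) ^+ (l + k)) +
    s / 2 * Re (b * (w ^+ i) ^+ (l + (N - k))).
  rewrite mulrDl mul1r -mulrA [Re _ * Re _]mulrC ReMRe.
  have -> : conjc ((w ^+ i) ^+ k) = (w ^+ i) ^+ (N - k).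
    rewrite conjc_unit_inv; last by rewrite !cmodX w1 !expr1n.
    have u0 : (w ^+ i) ^+ k != 0 by rewrite -cmod_eq0 !cmodX w1 !expr1n oner_eq0.
    apply: (mulIf u0); rewrite mulVf// -exprD subnK; last lia.
    by rewrite -exprM mulnC exprM (prim_expr_order wN) expr1n.
  by rewrite !exprD !mulrA; field.
under eq_bigr do rewrite term.
rewrite !big_split/= -!mulr_sumr !sumRe.
have nd e : (0 < e < N)%N -> (N %| e)%N = false.
  by move=> /andP[e0 eN]; rewrite gtnNdvd.
rewrite (nd l); last lia.
rewrite (nd (l + k)%N); last lia.
rewrite mulr0 !add0r.
have [->|lk] := eqVneq l k.
  have kN : (k <= N)%N by lia.
  by rewrite subnKC// dvdnn; field.
have [lk'|kl'] := ltnP l k; first by rewrite nd ?mulr0//; lia.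
have -> : (l + (N - k) = N + (l - k))%N by lia.
by rewrite dvdn_addr// nd ?mulr0//; lia.
Qed.

Lemma le_geometric_limit (x M E : R) k :
  (forall L, (k <= L)%N -> x <= M + E * 2^-1 ^+ L) -> x <= M.
Proof.
move=> h; apply/ler_addgt0Pr => e e0.
pose n := maxn k (Num.bound `|E / e|).
have nE : E / e <= n%:R.
  rewrite (le_trans (ler_norm _))// (le_trans (ltW (archi_boundP (normr_ge0 _))))//.
  by rewrite ler_nat leq_maxr.
apply: le_trans (h n (leq_maxl _ _)) _; rewrite lerD2l.
rewrite exprVn ler_pdivrMr ?exprn_gt0//.
rewrite ler_pdivrMr// mulrC in nE; apply: (le_trans nE).
by rewrite ler_wpM2l ?(ltW e0)// -natrX ler_nat ltnW// ltn_expl.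
Qed.

(* A pair [(m, a)] of [s] stands for a factor [(1 - a z)^m]. *)
Definition logprod (s : seq (R * R[i])) z : R :=
  \sum_(p <- s) p.1 * ln (cmod (1 - p.2 * z)).

(** For real [u], the coefficient of [u^k] in the expansion of [logprod s u] is
    [- powsum s k / k]. *)
Definition powsum (s : seq (R * R[i])) k : R := Re (\sum_(p <- s) p.1%:C%C * p.2 ^+ k).

Lemma logprod_series s z L : cmod z <= 1 -> all (fun p => cmod p.2 <= 2^-1) s ->
  `|logprod s z + \sum_(l < L)
     Re (\sum_(p <- s) p.1%:C%C * p.2 ^+ l.+1 * z ^+ l.+1) / l.+1%:R| <=
  (\sum_(p <- s) `|p.1|) * 2^-1 ^+ L.
Proof.
move=> z1 /allP hs; rewrite /logprod.
have -> : \sum_(l < L) Re (\sum_(p <- s) p.1%:C%C * p.2 ^+ l.+1 * z ^+ l.+1) / l.+1%:R =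
    \sum_(p <- s) p.1 * \sum_(l < L) Re ((p.2 * z) ^+ l.+1) / l.+1%:R.
  under eq_bigr do rewrite Re_sum mulr_suml.
  rewrite exchange_big /=; apply: eq_bigr => p _; rewrite mulr_sumr.
  by apply: eq_bigr => l _; rewrite -mulrA ReRM exprMn mulrA.
rewrite -big_split/= mulr_suml (le_trans (ler_norm_sum _ _ _))//.
rewrite big_seq [leRHS]big_seq; apply: ler_sum => p ps.
rewrite -mulrDr normrM ler_wpM2l//; apply: ln_cmod1B_series.
by rewrite cmodM (le_trans _ (hs p ps))// ler_piMr// cmod_ge0.
Qed.

(** A discrete Borel-Caratheodory inequality. The weights [1 + sg Re (zeta^k)] are nonnegative with
    mean 1, so the weighted mean of [logprod] is at most [M]; as [logprod] vanishes at 0, this mean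
    is [- sg powsum s k / (2 k)]. Both signs [sg] are needed for the absolute value. *)
Lemma powsum_bound s M k : (0 < k)%N -> all (fun p => cmod p.2 <= 2^-1) s ->
  (forall z, cmod z = 1 -> logprod s z <= M) ->
  `|powsum s k| <= 2 * k%:R * M.
Proof.
move=> k0 hs hM.
have k0R : 0 < k%:R :> R by rewrite ltr0n.
suff main (sg : R) : `|sg| = 1 -> - (sg * powsum s k) <= 2 * k%:R * M.
  rewrite ler_norml -lerNl. have := main 1; have := main (- 1).
  rewrite normrN normr1 => /(_ erefl) + /(_ erefl).
  by rewrite mul1r mulN1r opprK => -> ->.
move=> sg1; rewrite -ler_pdivrMl ?mulr_gt0//.
apply: (@le_geometric_limit _ _ (\sum_(p <- s) `|p.1|) k) => L kL.
set E := \sum_(p <- s) _.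
(* [N] exceeds [k + l] for all [l <= L], so no other coefficient of the truncated series aliases
   onto the [k]-th. *)
pose N := (k + L).+1; have [w wN] := @complex_prim_root N isT.
have w1 : cmod w = 1 := cmod_prim_root (ltn0Sn _) wN.
have u1 i : cmod (w ^+ i) = 1 by rewrite cmodX w1 expr1n.
pose W i := 1 + sg * Re ((w ^+ i) ^+ k).
have W0 i : 0 <= W i.
  have : `|sg * Re ((w ^+ i) ^+ k)| <= 1.
    by rewrite normrM sg1 mul1r (le_trans (ler_Re_cmod _))// cmodX u1 expr1n.
  by rewrite ler_norml => /andP[+ _]; rewrite /W; lra.
have sumW : \sum_(i < N) W i = N%:R.
  have := sum_prim_root k wN; rewrite gtnNdvd//; last by rewrite /N; lia.
  move=> /(congr1 (@complex.Re R)); rewrite Re_sum /= => h.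
  by rewrite /W big_split/= -mulr_sumr h mulr0 addr0 sumr_const card_ord.
pose S i := \sum_(l < L)
  Re (\sum_(p <- s) p.1%:C%C * p.2 ^+ l.+1 * (w ^+ i) ^+ l.+1) / l.+1%:R.
have lb : - (\sum_(i < N) W i * S i) - N%:R * (E * 2^-1 ^+ L) <= N%:R * M.
  have : forall i, - (E * 2^-1 ^+ L) <= logprod s (w ^+ i) + S i.
    move=> i; have := @logprod_series s (w ^+ i) L; rewrite u1 lexx => /(_ isT hs).
    by rewrite ler_norml => /andP[].
  move: (E * _) => e he.
  rewrite -!sumW !mulr_suml -sumrN -sumrB; apply: ler_sum => i _.
  rewrite -mulrN -mulrBr ler_wpM2l//.
  by have := hM _ (u1 i); have := he i; lra.
have SE : \sum_(i < N) W i * S i = N%:R / 2 * sg * powsum s k / k%:R.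
  rewrite /S; under eq_bigr do rewrite mulr_sumr.
  rewrite exchange_big /=.
  have term (l : 'I_L) : \sum_(i < N) W i *
      (Re (\sum_(p <- s) p.1%:C%C * p.2 ^+ l.+1 * w ^+ i ^+ l.+1) / l.+1%:R) =
      if l.+1 == k then N%:R / 2 * sg * powsum s k / k%:R else 0.
    under eq_bigr do rewrite -mulr_suml mulrA.
    rewrite -mulr_suml (sum_prim_root_weight _ _ wN)//; last first.
      by rewrite /N ltnS leq_add2l.
    by case: eqP => [<-//|_]; rewrite mul0r.
  under eq_bigr do rewrite term.
  have hk : (k.-1 < L)%N by lia.
  rewrite (bigD1 (Ordinal hk))//= prednK// eqxx big1 ?addr0// => l lk.
  case: eqP => // lk'; case/eqP: lk; apply: val_inj => /=; lia.
have N0 : 0 < N%:R :> R by rewrite ltr0n.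
rewrite -(ler_pM2l N0) mulrDr -lerBlDr; apply: le_trans lb; rewrite SE lerD2r.
rewrite le_eqVlt; apply/orP; left; apply/eqP; field.
by rewrite gt_eqF.
Qed.

(** The combination of values at [- v/2] and [- v] cancels the quadratic term. In order [k >= 3] the
    remaining factor is at most 1 in size and [powsum_bound] gives [2 M v^k]; the geometric sum
    contributes another 2. *)
Lemma powsum_three_point s M (v : R) : 0 <= v <= 2^-1 ->
  all (fun p => cmod p.2 <= 2^-1) s ->
  (forall z, cmod z = 1 -> logprod s z <= M) ->
  v * powsum s 1 <= 4 * logprod s (- (v / 2))%:C%C - logprod s (- v)%:C%C + 4 * M * v ^+ 3.
Proof.
move=> /andP[v0 v2] hs hM.
set E := \sum_(p <- s) `|p.1|.
have M0 : 0 <= M.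
  have := powsum_bound (ltn0Sn 0) hs hM; have := normr_ge0 (powsum s 1); lra.
apply: (@le_geometric_limit _ _ (5 * E) 2) => L L2.
have ser (u : R) : `|u| <= 2^-1 ->
    `|logprod s u%:C%C + \sum_(l < L) u ^+ l.+1 * powsum s l.+1 / l.+1%:R| <= E * 2^-1 ^+ L.
  move=> u2; have u1 : cmod (u%:C%C : R[i]) <= 1 by rewrite cmodR; lra.
  have := logprod_series L u1 hs.
  by under eq_bigr do rewrite -mulr_suml -rmorphXn [X in Re X]mulrC ReRM.
have u1 : `|- v| <= 2^-1 by rewrite normrN ger0_norm.
have u2 : `|- (v / 2)| <= 2^-1 by rewrite normrN ger0_norm ?divr_ge0//; lra.
move: (ser _ u1) (ser _ u2); rewrite !ler_norml => /andP[h11 h12] /andP[h21 h22].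
have key : v * powsum s 1 + 4 * \sum_(l < L) (- (v / 2)) ^+ l.+1 * powsum s l.+1 / l.+1%:R
    - \sum_(l < L) (- v) ^+ l.+1 * powsum s l.+1 / l.+1%:R <= 4 * M * v ^+ 3.
  have [L' ->] : exists L', L = L'.+2 by exists L.-2; lia.
  rewrite !big_ord_recl /=.
  rewrite (_ : v * _ + _ - _ = \sum_(l < L') (4 * (- (v / 2)) ^+ l.+3 - (- v) ^+ l.+3) *
      (powsum s l.+3 / l.+3%:R)); last first.
    under [RHS]eq_bigr do rewrite mulrBl -mulrA.
    rewrite sumrB -mulr_sumr; under eq_bigr do rewrite -mulrA.
    under [X in _ - (_ + (_ + X))]eq_bigr do rewrite -mulrA.
    by rewrite /bump /=; field.
  have geo : \sum_(l < L') v ^+ l <= 2.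
    have h : (1 - v) * \sum_(l < L') v ^+ l = 1 - v ^+ L'.
      by rewrite -opprB mulNr -subrX1 opprB.
    have p0 : 0 <= v ^+ L' by rewrite exprn_ge0.
    have S0 : 0 <= \sum_(l < L') v ^+ l by rewrite sumr_ge0// => l _; rewrite exprn_ge0.
    have : 2^-1 * \sum_(l < L') v ^+ l <= (1 - v) * \sum_(l < L') v ^+ l.
      by rewrite ler_wpM2r//; lra.
    by lra.
  apply: (@le_trans _ _ (\sum_(l < L') 2 * M * v ^+ 3 * v ^+ l)); last first.
    rewrite -mulr_sumr; have c0 : 0 <= 2 * M * v ^+ 3 by rewrite !mulr_ge0// exprn_ge0.
    by have := ler_wpM2l c0 geo; lra.
  apply: ler_sum => l _; apply: le_trans (ler_norm _) _; rewrite normrM.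
  rewrite -[2 * M * _ * _]mulrA -exprD addSnnS addSnnS addSnnS add0n mulrC.
  apply: ler_pM => //.
    rewrite normrM normfV normr_nat ler_pdivrMr ?ltr0n// mulrAC.
    exact: powsum_bound.
  have -> : 4 * (- (v / 2)) ^+ l.+3 - (- v) ^+ l.+3 =
      (- v) ^+ l.+3 * (4 * 2^-1 ^+ l.+3 - 1).
    by rewrite -mulNr exprMn; ring.
  rewrite normrM normrX normrN (ger0_norm v0) ler_piMr ?exprn_ge0//.
  have q0 : 0 <= (2^-1 : R) ^+ l.+3 by rewrite exprn_ge0.
  have q1 : (2^-1 : R) ^+ l.+3 <= 2^-1 by rewrite exprS ler_piMr// exprn_ile1//; lra.
  by rewrite ler_norml; apply/andP; split; lra.
lra.
Qed.

End PowerSums.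

(** * A zero near the branch point *)

Section Part2.
Context {R : realType}.
Implicit Types (z w : R[i]) (a x y M : R).

(** Equivalently, the derivative of [B(z)/(1+z)^n] is a single monomial over [(1+z)^(n+1)], which
    makes its slope at the branch point explicit. *)
Lemma binpoly_deriv r n z : (r <= n)%N ->
  (1 + z) * (binpoly R r n)^`().[z] =
  n%:R * (binpoly R r n).[z] - (n%:R - r%:R) * ('C(n, r)%:R * z ^+ r).
Proof.
elim: r => [|r IH] rn.
  rewrite /binpoly big_ord1 bin0 scale1r expr0 poly.derivE !hornerE /=.
  by rewrite subr0 !mulr1 subrr.
have -> : binpoly R r.+1 n = binpoly R r n + 'C(n, r.+1)%:R *: 'X^(r.+1).
  by rewrite /binpoly big_ord_recr.
rewrite derivD derivZ derivXn !hornerD !hornerZ hornerMn hornerXn hornerXn /=.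
rewrite mulrDr (IH (ltnW rn)) -[z ^+ r *+ _]mulr_natl.
have h : r.+1%:R * 'C(n, r.+1)%:R = (n%:R - r%:R) * 'C(n, r)%:R :> R[i].
  by rewrite -natrB ?(ltnW rn)// -!natrM mul_bin_left.
have -> : (1 + z) * ('C(n, r.+1)%:R * (r.+1%:R * z ^+ r)) =
  (r.+1%:R * 'C(n, r.+1)%:R) * z ^+ r + r.+1%:R * 'C(n, r.+1)%:R * (z * z ^+ r) by ring.
by rewrite {1}h exprS; ring.
Qed.

Lemma logderiv_prod_XsubC (rs : seq R[i]) z : all (fun w => z - w != 0) rs ->
  (\prod_(w <- rs) ('X - w%:P))^`().[z] =
  (\prod_(w <- rs) ('X - w%:P)).[z] * \sum_(w <- rs) (z - w)^-1.
Proof.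
elim: rs => [_|w rs IH /= /andP[zw /IH h]]; first by rewrite !big_nil !poly.derivE !hornerE.
rewrite !big_cons derivM !hornerE h /= !poly.derivE !hornerE /=.
by field.
Qed.

Lemma ln_cmod_prod (rs : seq R[i]) (f : R[i] -> R[i]) : all (fun w => f w != 0) rs ->
  ln (cmod (\prod_(w <- rs) f w)) = \sum_(w <- rs) ln (cmod (f w)).
Proof.
elim: rs => [_|w rs IH /= /andP[fw h]]; first by rewrite !big_nil cmod1 ln1.
rewrite !big_cons cmodM lnM ?IH// posrE cmod_gt0// prodf_seq_neq0.
exact: h.
Qed.

Lemma binpoly_real r n y :
  (binpoly R r n).[y%:C%C] = (\sum_(k < r.+1) 'C(n, k)%:R * y ^+ k)%:C%C.
Proof.
rewrite horner_binpoly rmorph_sum; apply: eq_bigr => k _.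
by rewrite rmorphM rmorphXn.
Qed.

Lemma cmod_binpoly_le r n z : (r < n)%N ->
  cmod (binpoly R r n).[z] <= (1 + cmod z) ^+ n.
Proof.
move=> rn; rewrite horner_binpoly (exprD1n_split _ rn).
apply: (@le_trans _ _ (\sum_(k < r.+1) 'C(n, k)%:R * cmod z ^+ k)).
  exact: (@ler_cmod_psum R (fun k => 'C(n, k)%:R)).
rewrite lerDl mulr_ge0 ?exprn_ge0 ?cmod_ge0// sumr_ge0// => k _.
by rewrite mulr_ge0// exprn_ge0 ?cmod_ge0.
Qed.

(** Splitting both powers into head and tail, the product of the two heads cancels. Each head
    exponent is below each tail exponent, so moving the larger argument to the tail increases the
    product. *)
Lemma binpoly_ratio_decr r n y y' : (r < n)%N -> 0 <= y <= y' ->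
  (\sum_(k < r.+1) 'C(n, k)%:R * y' ^+ k) * (1 + y) ^+ n <=
  (\sum_(k < r.+1) 'C(n, k)%:R * y ^+ k) * (1 + y') ^+ n.
Proof.
move=> rn /andP[y0 yy']; have y'0 := le_trans y0 yy'.
rewrite !(exprD1n_split _ rn).
set B := \sum_(k < r.+1) _ * y ^+ k; set B' := \sum_(k < r.+1) _ * y' ^+ k.
rewrite !mulrDr [B * B']mulrC lerD2l !mulrA.
have mono j : y ^+ j <= y' ^+ j by rewrite lerXn2r ?nnegrE.
apply: ler_pM.
- by rewrite mulr_ge0 ?exprn_ge0// sumr_ge0// => k _; rewrite mulr_ge0// exprn_ge0.
- by rewrite sumr_ge0// => k _; rewrite mulr_ge0// exprn_ge0.
- rewrite !mulr_suml; apply: ler_sum => k _; rewrite -!mulrA ler_wpM2l//.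
  have e (u : R) : u ^+ r.+1 = u ^+ k * u ^+ (r.+1 - k).
    by rewrite -exprD subnKC// ltnW.
  rewrite !e mulrCA; apply: ler_wpM2l; first by rewrite exprn_ge0.
  by apply: ler_wpM2l; first by rewrite exprn_ge0.
- by apply: ler_sum => k _; rewrite ler_wpM2l.
Qed.

(** With [p = x + z], [(1 + |p|)^2 - |1 + p|^2 = 2 (|p| - Re p)]. Moreover [(|p| + Re p) (|p| - Re
    p) = (Im z)^2 <= rho^2], where the first factor is at least [x]. *)
Lemma cmod_ratio_le x z (rho : R) : 0 < x -> cmod z <= rho -> rho <= x / 2 ->
  ln (1 + cmod (x%:C%C + z)) - ln (cmod (1 + (x%:C%C + z))) <= rho ^+ 2 / x.
Proof.
move=> x0 zr rx; set p := x%:C%C + z.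
have := ler_Re_cmod z; rewrite ler_norml => /andP[re1 re2].
have rp : x / 2 <= Re p by rewrite ReD /=; lra.
have p1 : Re p <= cmod p by rewrite (le_trans (ler_norm _))// ler_Re_cmod.
have p0 : 0 < cmod p by rewrite (lt_le_trans _ p1)// (lt_le_trans _ rp)// divr_gt0.
have p1' : 1 <= cmod (1 + p).
  apply: le_trans (ler_Re_cmod _); rewrite (le_trans _ (ler_norm _))// ReD /=.
  have : 0 < x / 2 by rewrite divr_gt0.
  lra.
have h : x * (cmod p - Re p) <= rho ^+ 2.
  apply: (@le_trans _ _ ((cmod p + Re p) * (cmod p - Re p))).
    by rewrite ler_wpM2r//; lra.
  have -> : (cmod p + Re p) * (cmod p - Re p) = Im z ^+ 2.
    rewrite mulrC -subr_sqr sqr_cmod ImD /=. ring.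
  apply: (@le_trans _ _ (cmod z ^+ 2)).
    by rewrite sqr_cmod lerDr sqr_ge0.
  by rewrite lerXn2r ?nnegrE ?cmod_ge0// (le_trans (cmod_ge0 z)).
have c1 : 0 < cmod (1 + p) by lra.
have c2 : 0 < 1 + cmod p by lra.
have l := @ln_le_subr1 R ((1 + cmod p) ^+ 2 / cmod (1 + p) ^+ 2).
have {}l := l (divr_gt0 (exprn_gt0 _ c2) (exprn_gt0 _ c1)).
rewrite ln_div ?posrE ?exprn_gt0// lnXn// lnXn// in l.
have e : (1 + cmod p) ^+ 2 / cmod (1 + p) ^+ 2 - 1 =
    2 * (cmod p - Re p) / cmod (1 + p) ^+ 2.
  have -> : 2 * (cmod p - Re p) = (1 + cmod p) ^+ 2 - cmod (1 + p) ^+ 2.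
    by rewrite sqr_cmod1D; ring.
  by rewrite mulrBl divff// gt_eqF// exprn_gt0.
have e' : 2 * (cmod p - Re p) / cmod (1 + p) ^+ 2 <= 2 * (rho ^+ 2 / x).
  rewrite ler_pdivrMr ?exprn_gt0//.
  have q0 : 0 <= 2 * (rho ^+ 2 / x) by rewrite mulr_ge0// divr_ge0 ?sqr_ge0// ltW.
  apply: le_trans (_ : 2 * (rho ^+ 2 / x) <= _); last by rewrite ler_peMr// expr_ge1//; lra.
  by rewrite ler_wpM2l// ler_pdivlMr// mulrC.
move: l; rewrite e !mulr2n; lra.
Qed.

End Part2.

(** * Consequences of a zero-free disc around the branch point *)

Section ZeroFree.
Context {R : realType} (r n : nat) (rho : R) (rn : (0 < r < n)%N).
Let a : R := r%:R / n%:R.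
Let x : R := a / (1 - a).
(** The probability that a binomial variable does not exceed its mean; also the value of
    [B(y)/(1+y)^n] at [y = x]. *)
Let Q : R := \sum_(k < r.+1) binw n a k.
Context (rho_gt0 : 0 < rho) (rho_le : rho <= 2^-1) (rho_x : rho <= x / 2).
Context (zero_free :
  forall z : R[i], root (binpoly R r n) z -> 2 * rho <= cmod (z - x%:C%C)).

Let P := binpoly R r n.
Let B (y : R) : R := \sum_(k < r.+1) 'C(n, k)%:R * y ^+ k.

Let n_gt0 : 0 < n%:R :> R.
Proof. by case/andP: rn => r0 rn'; rewrite ltr0n (ltn_trans r0). Qed.

Let nar : n%:R * a = r%:R.
Proof. by rewrite /a mulrCA divff ?mulr1// gt_eqF. Qed.

Let a_gt0 : 0 < a.
Proof. by case/andP: rn => r0 _; rewrite divr_gt0// ltr0n. Qed.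

Let a_lt1 : a < 1.
Proof. by case/andP: rn => _ rn'; rewrite ltr_pdivrMr// mul1r ltr_nat. Qed.

Let b_gt0 : 0 < 1 - a. Proof. by rewrite subr_gt0. Qed.

Let x_gt0 : 0 < x. Proof. by rewrite divr_gt0. Qed.

Let x1E : 1 + x = (1 - a)^-1.
Proof. by rewrite /x; field; rewrite gt_eqF. Qed.

Let x1_gt0 : 0 < 1 + x. Proof. by rewrite addr_gt0. Qed.

Let binwE k : (k <= n)%N -> 'C(n, k)%:R * x ^+ k = binw n a k * (1 + x) ^+ n.
Proof.
move=> kn; have e : (1 - a) ^+ n = (1 - a) ^+ k * (1 - a) ^+ (n - k).
  by rewrite -exprD subnKC.
have c j : (1 - a) ^+ j != 0 by rewrite expf_neq0// gt_eqF.
rewrite x1E /binw exprVn e /x expr_div_n.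
by field; rewrite !c.
Qed.

Let BxE : B x = Q * (1 + x) ^+ n.
Proof.
rewrite /B /Q mulr_suml; apply: eq_bigr => k _; apply: binwE.
by case/andP: rn => _ rn'; rewrite -ltnS (leq_trans (ltn_ord k))// ltnS ltnW.
Qed.

Let B_gt0 y : 0 <= y -> 0 < B y.
Proof.
move=> y0; rewrite /B big_ord_recl /= bin0 expr0 mulr1 ltr_pwDl// sumr_ge0// => k _.
by rewrite mulr_ge0// exprn_ge0.
Qed.

Let Q_gt0 : 0 < Q.
Proof.
have := B_gt0 (ltW x_gt0); rewrite BxE pmulr_lgt0// exprn_gt0//.
Qed.

Let B_le y : 0 <= y -> B y <= (1 + y) ^+ n.
Proof.
move=> y0; case/andP: rn => _ rn'; rewrite (exprD1n_split _ rn') lerDl.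
by rewrite mulr_ge0 ?exprn_ge0// sumr_ge0// => k _; rewrite mulr_ge0// exprn_ge0.
Qed.

Let Q_le1 : Q <= 1.
Proof.
have := B_le (ltW x_gt0).
by rewrite BxE -[leRHS]mul1r ler_pM2r// exprn_gt0.
Qed.

Let PR y : P.[y%:C%C] = (B y)%:C%C. Proof. exact: binpoly_real. Qed.

Let P_neq0 z : cmod (z - x%:C%C) <= rho -> P.[z] != 0.
Proof.
move=> zx; apply/negP => Pz; have h := le_trans (zero_free Pz) zx.
by move: rho_gt0; lra.
Qed.

Let rs : seq R[i] := sval (closed_field_poly_normal P).

Let PE : P = lead_coef P *: \prod_(w <- rs) ('X - w%:P).
Proof. exact: svalP (closed_field_poly_normal P). Qed.

Let lead_neq0 : lead_coef P != 0.
Proof.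
rewrite lead_coef_eq0; apply/eqP => P0.
by have := PR x; rewrite P0 horner0 => /(congr1 (@complex.Re R))/= /eqP;
  rewrite lt_eqF// B_gt0// ltW.
Qed.

Let rs_root w : w \in rs -> root P w.
Proof. by move=> ws; rewrite PE rootZ// root_prod_XsubC. Qed.

Let rs_far w : w \in rs -> 2 * rho <= cmod (w - x%:C%C).
Proof. by move=> /rs_root; exact: zero_free. Qed.

Let hornerP z : P.[z] = lead_coef P * \prod_(w <- rs) (z - w).
Proof.
rewrite {1}PE hornerZ horner_prod; congr (_ * _); apply: eq_bigr => w _.
by rewrite !hornerE.
Qed.

(* The zeros of [B] and the pole [-1] of [B / (1 + z)^n], seen from [x] at scale
   [rho]. *)
Let s : seq (R * R[i]) :=
  (- n%:R, (- (rho / (1 + x)))%:C%C) :: [seq (1, rho%:C%C / (w - x%:C%C)) | w <- rs].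

Let s_small : all (fun p => cmod p.2 <= 2^-1) s.
Proof.
apply/allP => p; rewrite in_cons => /predU1P[->|/mapP[w ws ->]].
  rewrite -[_.2]/((- (rho / (1 + x)))%:C%C) cmodR normrN.
  rewrite ger0_norm ?divr_ge0 ?(ltW rho_gt0) ?(ltW x1_gt0)//.
  by rewrite ler_pdivrMr// (le_trans rho_le)// ler_peMr// lerDl ltW.
have h := rs_far ws; rewrite -[_.2]/(rho%:C%C / (w - x%:C%C)).
have h0 : 0 < cmod (w - x%:C%C) by apply: lt_le_trans h; rewrite mulr_gt0.
rewrite cmodM cmodR cmodV ger0_norm ?(ltW rho_gt0)// ler_pdivrMr//; move: h; lra.
Qed.

Let wx w : w \in rs -> w - x%:C%C != 0.
Proof. by move=> ws; rewrite -cmod_gt0 (lt_le_trans _ (rs_far ws))// mulr_gt0. Qed.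

Let oneD (u : R) : 1 + u%:C%C = (1 + u)%:C%C :> R[i].
Proof. by rewrite rmorphD rmorph1. Qed.

Let xC1 : 1 + x%:C%C = (1 + x)%:C%C :> R[i] := oneD x.

(** Each zero contributes [(p - w)/(x - w) = 1 - rho z / (w - x)], and the pole is treated in the
    same way. So [logprod s] is the logarithm of [|B/(1+z)^n|] at [p], normalized by its value at
    [x]. *)
Let logprodE z : cmod z <= 1 ->
  let p := x%:C%C + rho%:C%C * z in
  logprod s z = (ln (cmod P.[p]) - n%:R * ln (cmod (1 + p))) -
    (ln (B x) - n%:R * ln (1 + x)).
Proof.
move=> z1 p.
have pz : cmod (p - x%:C%C) <= rho.
  by rewrite /p addrAC subrr add0r cmodM cmodR gtr0_norm// ler_piMr// ltW.
have wp w : w \in rs -> p - w != 0.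
  move=> ws; rewrite subr_eq0; apply: contraTneq pz => ->.
  by rewrite -ltNge (lt_le_trans _ (rs_far ws))//; move: rho_gt0; lra.
have -> : ln (B x) = ln (cmod P.[x%:C%C]) by rewrite PR cmodR gtr0_norm// B_gt0// ltW.
have lnP q : (forall w, w \in rs -> q - w != 0) ->
    ln (cmod P.[q]) = ln (cmod (lead_coef P)) + \sum_(w <- rs) ln (cmod (q - w)).
  move=> qs; have a0 : all (fun w => q - w != 0) rs by apply/allP.
  rewrite hornerP cmodM lnM ?posrE ?cmod_gt0//; last by rewrite prodf_seq_neq0.
  by rewrite ln_cmod_prod.
rewrite (lnP _ wp) (lnP x%:C%C); last by move=> w /wx; rewrite -opprB oppr_eq0.
have -> : 1 + p = (1 + x)%:C%C * (1 - (- (rho / (1 + x)))%:C%C * z).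
  have e : (1 + x)%:C%C * (rho / (1 + x))%:C%C = rho%:C%C :> R[i].
    by rewrite -rmorphM mulrC divfK ?gt_eqF.
  by rewrite rmorphN mulNr opprK mulrDr mulr1 mulrA e /p -xC1 addrA.
have small : cmod ((- (rho / (1 + x)))%:C%C * z) <= 2^-1.
  have /allP/(_ (- n%:R, (- (rho / (1 + x)))%:C%C)) := s_small.
  rewrite mem_head => /(_ isT); rewrite -[_.2]/((- (rho / (1 + x)))%:C%C) => h.
  by rewrite cmodM (le_trans _ h)// ler_piMr// cmod_ge0.
rewrite cmodM lnM ?posrE ?cmod_1B_gt0//; last by rewrite cmodR gtr0_norm.
rewrite cmodR gtr0_norm// /logprod /s big_cons big_map /=.
have -> : \sum_(w <- rs) 1 * ln (cmod (1 - rho%:C%C / (w - x%:C%C) * z)) =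
    \sum_(w <- rs) ln (cmod (p - w)) - \sum_(w <- rs) ln (cmod (x%:C%C - w)).
  rewrite -sumrB big_seq [RHS]big_seq; apply: eq_bigr => w ws; rewrite mul1r.
  have w0 := wx ws; have w1 : x%:C%C - w != 0 by rewrite -opprB oppr_eq0.
  have -> : 1 - rho%:C%C / (w - x%:C%C) * z = (p - w) / (x%:C%C - w).
    by rewrite /p; field; rewrite ?w0 ?w1.
  by rewrite cmodM cmodV lnM ?posrE ?invr_gt0 ?cmod_gt0 ?wp// lnV// posrE cmod_gt0.
by ring.
Qed.

(** This is [- rho] times the logarithmic derivative of [B/(1+z)^n] at [x]: in [binpoly_deriv] the
    term [n B] cancels against the pole. *)
Let powsum1 : powsum s 1 = rho * (n%:R - r%:R) * (1 - a) * binw n a r / Q.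
Proof.
have rn' : (r < n)%N by case/andP: rn.
have B0 : B x != 0 by rewrite gt_eqF// B_gt0// ltW.
have PB : P.[x%:C%C] != 0 by rewrite PR -cmod_eq0 cmodR normr_eq0.
have log_deriv : P^`().[x%:C%C] = P.[x%:C%C] * \sum_(w <- rs) (x%:C%C - w)^-1.
  rewrite {1}PE derivZ hornerZ logderiv_prod_XsubC; last first.
    by apply/allP => w /wx; rewrite -opprB oppr_eq0.
  by rewrite mulrA -hornerZ -PE.
have ode := binpoly_deriv x%:C%C (ltnW rn'); rewrite -/P in ode.
have c1 : 1 + x%:C%C != 0 :> R[i] by rewrite xC1 -cmod_eq0 cmodR normr_eq0 gt_eqF.
have S1 : \sum_(w <- rs) (x%:C%C - w)^-1 = P^`().[x%:C%C] / P.[x%:C%C].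
  by rewrite log_deriv mulrC mulKf.
have {ode} dE : P^`().[x%:C%C] =
    (n%:R * P.[x%:C%C] - (n%:R - r%:R) * ('C(n, r)%:R * x%:C%C ^+ r)) / (1 + x%:C%C).
  by rewrite -ode mulrC mulKf.
rewrite /powsum /s big_cons big_map /=.
have -> : \sum_(w <- rs) 1%:C%C * (rho%:C%C / (w - x%:C%C)) ^+ 1 =
    - rho%:C%C * \sum_(w <- rs) (x%:C%C - w)^-1.
  rewrite mulr_sumr; apply: eq_bigr => w _.
  by rewrite rmorph1 mul1r expr1 -[w - _]opprB invrN mulrN mulNr.
rewrite S1 dE.
transitivity (Re (rho * (n%:R - r%:R) * ('C(n, r)%:R * x ^+ r) / ((1 + x) * B x))%:C%C).
  congr (Re _); rewrite PR xC1.
  rewrite !(rmorphM, rmorphN, fmorphV, rmorphXn, rmorphB, rmorph_nat) /=.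
  have c3 : (B x)%:C%C != 0 :> R[i] by rewrite -PR.
  by rewrite expr1; field; apply/andP; split; [exact: c3|exact: c1].
rewrite -[LHS]/(rho * (n%:R - r%:R) * ('C(n, r)%:R * x ^+ r) / ((1 + x) * B x)).
rewrite (binwE (ltnW rn')) BxE x1E.
have b0 : 1 - a != 0 by rewrite gt_eqF.
have Q0 : Q != 0 by rewrite gt_eqF.
have e0 : (1 - a)^-1 ^+ n != 0 by rewrite expf_neq0// invr_eq0.
by field; rewrite b0 Q0 e0.
Qed.

Let lnBx : ln (B x) = ln Q + n%:R * ln (1 + x).
Proof. by rewrite BxE lnM ?posrE ?exprn_gt0// lnXn// mulr_natl. Qed.

Let logprod_le z : cmod z = 1 -> logprod s z <= n%:R * (rho ^+ 2 / x) - ln Q.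
Proof.
move=> z1; rewrite logprodE ?z1// lnBx; set p := x%:C%C + _.
have rz : cmod (rho%:C%C * z) <= rho by rewrite cmodM z1 mulr1 cmodR gtr0_norm.
have rn' : (r < n)%N by case/andP: rn.
have Pp : P.[p] != 0 by apply: P_neq0; rewrite /p addrAC subrr add0r.
have := cmod_ratio_le x_gt0 rz rho_x; rewrite -/p => /(ler_wpM2l (ltW n_gt0)) h.
have h' : ln (cmod P.[p]) <= n%:R * ln (1 + cmod p).
  have p0 : 0 < 1 + cmod p by rewrite ltr_pwDl// cmod_ge0.
  rewrite mulr_natl -lnXn// ler_ln ?posrE ?exprn_gt0 ?cmod_gt0//.
  exact: cmod_binpoly_le.
by rewrite mulrBr in h; lra.
Qed.

(** To the left of [x] the ratio [B(y)/(1+y)^n] lies between its value [Q] at [x], by monotonicity,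
    and 1. *)
Let logprod_real (v : R) : 0 <= v <= 2^-1 -> 0 <= logprod s (- v)%:C%C <= - ln Q.
Proof.
move=> /andP[v0 v2]; have rn' : (r < n)%N by case/andP: rn.
have v1 : cmod ((- v)%:C%C : R[i]) <= 1 by rewrite cmodR normrN ger0_norm//; lra.
rewrite logprodE//; have := rho_x; have := x_gt0; have := rho_gt0 => r0 x0 rx.
pose y := x - rho * v.
have rv : rho * v <= rho by rewrite ler_piMr ?(ltW r0)//; lra.
have rv0 : 0 <= rho * v by rewrite mulr_ge0// ltW.
have y0 : 0 <= y by rewrite /y; lra.
have yx : 0 <= y <= x by rewrite y0 /y; lra.
have -> : x%:C%C + rho%:C%C * (- v)%:C%C = y%:C%C :> R[i].
  by rewrite -rmorphM -rmorphD mulrN.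
rewrite oneD.
have By := B_gt0 y0; have y1 : 0 < 1 + y by rewrite ltr_pwDl.
have Bx := B_gt0 (ltW x0).
rewrite PR !cmodR !gtr0_norm//.
have le1 : ln (B x) + n%:R * ln (1 + y) <= ln (B y) + n%:R * ln (1 + x).
  rewrite !mulr_natl -!lnXn// -!lnM ?posrE ?exprn_gt0//.
  rewrite ler_ln ?posrE ?mulr_gt0 ?exprn_gt0//.
  exact: binpoly_ratio_decr.
have le2 : ln (B y) <= n%:R * ln (1 + y).
  by rewrite mulr_natl -lnXn// ler_ln ?posrE ?exprn_gt0// B_le.
by rewrite lnBx in le1 *; apply/andP; split; lra.
Qed.

Lemma zero_free_mode_le (v : R) : 0 <= v <= 2^-1 ->
  v * (rho * n%:R * (1 - a) ^+ 2 * binw n a r) <=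
  - 4 * ln Q + 4 * (n%:R * (rho ^+ 2 / x) - ln Q) * v ^+ 3.
Proof.
move=> v01; have /andP[v0 v2] := v01.
have v01' : 0 <= v / 2 <= 2^-1 by apply/andP; split; lra.
have := powsum_three_point v01 s_small logprod_le.
have /andP[l1 _] := logprod_real v01; have /andP[_ l2] := logprod_real v01'.
have t0 : 0 <= binw n a r by rewrite binw_ge0// !ltW.
have : v * (rho * n%:R * (1 - a) ^+ 2 * binw n a r) <= v * powsum s 1.
  rewrite ler_wpM2l// powsum1 ler_pdivlMr//.
  have nr : n%:R - r%:R = n%:R * (1 - a) by rewrite -nar; ring.
  have m0 : 0 <= rho * n%:R * (1 - a) ^+ 2 * binw n a r.
    rewrite mulr_ge0 // mulr_ge0 ?sqr_ge0 //.
    by rewrite mulr_ge0 ?(ltW rho_gt0) ?(ltW n_gt0).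
  have -> : rho * (n%:R - r%:R) * (1 - a) * binw n a r =
     rho * n%:R * (1 - a) ^+ 2 * binw n a r by rewrite nr; ring.
  by rewrite ler_piMr.
by lra.
Qed.

End ZeroFree.

(** * Choice of constants and the second estimate *)

Section Part2Final.
Context {R : realType}.

Lemma binpoly_root_near_zpoint (delta : R) : 0 < delta ->
  exists (c : R) (N : nat), forall r n : nat,
    (1 <= r <= n)%N -> (N < n)%N -> delta < r%:R / n%:R < 1 - delta ->
    exists2 z, root (binpoly R r n) z & cmod (z - zpoint R r n) <= c / Num.sqrt n%:R.
Proof.
(* [q0] bounds [Q] from below, by [sum_binw_lb] and [binw_mode_lb]. [zero_free_mode_le] will be used
   with [rho = K / sqrt n] and [v = S / K]. [S] makes its left side at least [4 l + 2]; [K >= T]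
   makes the cubic term at most 1, so that the right side is at most [4 l + 1]; [K >= 2 S] ensures
   [v <= 1/2]. *)
move=> d0; pose q0 := delta ^+ 2 / 64.
have q00 : 0 < q0 by rewrite divr_gt0// exprn_gt0.
pose l := `|ln q0|; have l0 : 0 <= l by rewrite normr_ge0.
pose S := 8 * (4 * l + 2) / delta ^+ 2.
have S0 : 0 < S by rewrite divr_gt0 ?exprn_gt0//; lra.
have dl0 : 0 < delta^-1 + l by rewrite ltr_pwDl// invr_gt0.
pose T := 4 * S ^+ 3 * (delta^-1 + l).
have T0 : 0 < T by rewrite mulr_gt0// mulr_gt0// exprn_gt0.
pose K := T + 2 * S + 1.
have K1 : 1 <= K by rewrite /K; lra.
have KT : T <= K by rewrite /K; lra.
have KS : 2 * S <= K by rewrite /K; lra.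
have K0 : 0 < K by lra.
(* The threshold gives [K / sqrt n <= delta / 2], hence both [rho <= 1/2] and [rho <= x / 2]. *)
exists (2 * K), (Num.bound ((2 * K / delta) ^+ 2)) => r n /andP[r1 rn] Nn.
set a : R := r%:R / n%:R; move=> da; have /andP[da1 da2] := da.
have n0 : (0 < n)%N by rewrite (leq_ltn_trans _ Nn).
have n0R : 0 < n%:R :> R by rewrite ltr0n.
have a0 : 0 < a by lra.
have a1 : a < 1 by lra.
have rn' : (r < n)%N by move: a1; rewrite ltr_pdivrMr// mul1r ltr_nat.
have nar : n%:R * a = r%:R by rewrite /a mulrCA divff ?mulr1// gt_eqF.
rewrite (zpointE rn') -/a; set x := a / (1 - a).
pose sn : R := Num.sqrt n%:R; rewrite -/sn.
have sn0 : 0 < sn by rewrite sqrtr_gt0.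
have sn2 : sn ^+ 2 = n%:R by rewrite sqr_sqrtr// ltW.
have Ksn : K / sn <= delta / 2.
  have h : 2 * K / delta <= sn.
    rewrite -(@ler_pXn2r _ 2) ?nnegrE ?(ltW sn0) ?divr_ge0 ?mulr_ge0 ?(ltW K0) ?(ltW d0)//.
    rewrite sn2 (le_trans (ltW (archi_boundP _))) ?sqr_ge0// ler_nat ltnW//.
  rewrite ler_pdivrMr// mulrAC ler_pdivlMr// [delta * _]mulrC.
  by rewrite ler_pdivrMr// in h; lra.
apply: contrapT => no_root.
have far z : root (binpoly R r n) z -> 2 * (K / sn) <= cmod (z - x%:C%C).
  move=> zr; rewrite leNgt; apply/negP => zx; apply: no_root; exists z => //.
  by rewrite -mulrA ltW.
have xa : delta <= x.
  rewrite /x ler_pdivlMr ?subr_gt0//; apply: (@le_trans _ _ delta); last exact: ltW.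
  by rewrite ler_piMr ?(ltW d0)//; lra.
have rn0 : (0 < r < n)%N by rewrite r1.
have rho0 : 0 < K / sn by rewrite divr_gt0.
have rho2 : K / sn <= 2^-1 by lra.
have rhox : K / sn <= a / (1 - a) / 2 by rewrite -/x; lra.
have v01 : 0 <= S / K <= 2^-1.
  by rewrite divr_ge0 ?(ltW S0) ?(ltW K0)//= ler_pdivrMr//; lra.
have := zero_free_mode_le rn0 rho0 rho2 rhox far v01.
rewrite -/a; set Q := \sum_(k < _) _; set t := binw n a r.
have t8 : 1 <= 8 * sn * t.
  by apply: binw_mode_lb => //; rewrite (ltW a0).
have t0 : 0 <= t by rewrite /t binw_ge0// !ltW.
have Qlb : q0 <= Q.
  apply: le_trans (sum_binw_lb nar rn _); last by rewrite a0.
  rewrite -/t /q0 ler_pdivrMr//.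
  have -> : n%:R * a * (1 - a) * t ^+ 2 * 64 = a * (1 - a) * (8 * sn * t) ^+ 2.
    by rewrite -sn2; ring.
  have d2 : delta ^+ 2 <= a * (1 - a) by rewrite expr2; apply: ler_pM; lra.
  by rewrite (le_trans d2)// ler_peMr ?exprn_ege1// mulr_ge0; lra.
have lQ : - ln Q <= l.
  have : ln q0 <= ln Q by rewrite ler_ln ?posrE// (lt_le_trans q00).
  have : - ln q0 <= l by rewrite /l -normrN ler_norm.
  lra.
have lhs : S * (delta ^+ 2 / 8) <= S / K * (K / sn * n%:R * (1 - a) ^+ 2 * t).
  have -> : S / K * (K / sn * n%:R * (1 - a) ^+ 2 * t) =
      S * ((1 - a) ^+ 2 * (8 * sn * t) / 8).
    by rewrite -sn2; field; rewrite !gt_eqF.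
  rewrite ler_pM2l// ler_pM2r//.
  apply: (@le_trans _ _ ((1 - a) ^+ 2)); last by rewrite ler_peMr ?sqr_ge0.
  by rewrite lerXn2r ?nnegrE; lra.
have M1 : n%:R * ((K / sn) ^+ 2 / x) - ln Q <= K ^+ 2 * (delta^-1 + l).
  have -> : n%:R * ((K / sn) ^+ 2 / x) = K ^+ 2 * x^-1.
    by rewrite -sn2; field; rewrite !gt_eqF// (lt_le_trans d0).
  rewrite mulrDr; apply: lerD.
    by rewrite ler_wpM2l ?sqr_ge0// lef_pV2 ?posrE// (lt_le_trans d0).
  by rewrite (le_trans lQ)// ler_peMl// exprn_ege1.
have cube : 4 * (K ^+ 2 * (delta^-1 + l)) * (S / K) ^+ 3 <= 1.
  have -> : 4 * (K ^+ 2 * (delta^-1 + l)) * (S / K) ^+ 3 = T / K.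
    by rewrite /T; field; rewrite !gt_eqF.
  by rewrite ler_pdivrMr// mul1r.
have rhs : 4 * (n%:R * ((K / sn) ^+ 2 / x) - ln Q) * (S / K) ^+ 3 <= 1.
  apply: le_trans cube; rewrite ler_wpM2r ?ler_wpM2l//.
  by rewrite exprn_ge0//; case/andP: v01.
have SE : S * (delta ^+ 2 / 8) = 4 * l + 2.
  by rewrite /S; field; rewrite gt_eqF.
by rewrite -/x; lra.
Qed.

Lemma seq_argmin (T : eqType) (f : T -> R) (s : seq T) : s != [::] ->
  exists2 y, y \in s & forall z, z \in s -> f y <= f z.
Proof.
elim: s => // y [|y' s] IH _.
  by exists y; rewrite ?mem_head// => z; rewrite inE => /eqP ->.
have [u us um] := IH isT; have [yu|uy] := leP (f y) (f u).
  exists y; first exact: mem_head.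
  by move=> z; rewrite in_cons => /predU1P[->//|/um]; exact: le_trans.
exists u; first by rewrite in_cons us orbT.
by move=> z; rewrite in_cons => /predU1P[->|/um//]; exact: ltW.
Qed.

Lemma root_dist_min (p : {poly R[i]}) (w : R[i]) : p != 0 -> (exists z, root p z) ->
  exists m : R, is_min [set cmod (z - w) | z in [set z : R[i] | root p z]] m.
Proof.
move=> p0 [z0 pz0]; have [rs pE] := closed_field_poly_normal p.
have rsP z : root p z = (z \in rs).
  by rewrite pE rootZ ?root_prod_XsubC// lead_coef_eq0.
have rs0 : rs != [::] by apply/eqP => rs0; move: pz0; rewrite rsP rs0.
have [z zr zm] := seq_argmin (fun z => cmod (z - w)) rs0.
exists (cmod (z - w)); split; first by exists z => //=; rewrite rsP.
by move=> _ [u /= pu <-]; apply: zm; rewrite -rsP.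
Qed.

Lemma binpoly_neq0 r n : binpoly R r n != 0.
Proof.
apply/eqP => h; have := @horner_binpoly R r n 0; rewrite h horner0.
rewrite big_ord_recl bin0 expr0 mulr1 big1 ?addr0 => [/eqP|k _].
  by rewrite rmorph1 eq_sym oner_eq0.
by rewrite expr0n mulr0.
Qed.

End Part2Final.

Unset Implicit Arguments.
Set Strict Implicit.
Set Printing Implicit Defensive.

Theorem theorem2p3 (R : realType) (delta : R) (hdelta : 0 < delta < 1) :
  (exists (c : R) (N : nat), forall r n : nat,
     (1 <= r <= n)%N -> (N < r)%N -> (N < n)%N ->
     delta < r%:R / n%:R < 1 - delta ->
     forall zs : R[i], root (binpoly R r n) zs ->
     exists m : R,
       is_min [set cmod (zs - zeta) | zeta in Ccurve (r%:R / n%:R)] m /\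
       m <= c / cmod (zs - zpoint R r n) * (ln n%:R / n%:R))
  /\
  (exists (c : R) (N : nat), forall r n : nat,
     (1 <= r <= n)%N -> (N < r)%N -> (N < n)%N ->
     delta < r%:R / n%:R < 1 - delta ->
     exists m : R,
       is_min [set cmod (zs - zpoint R r n) | zs in
                 [set z : R[i] | root (binpoly R r n) z]] m /\
       m <= c / Num.sqrt n%:R).
Proof.
have /andP[d0 _] := hdelta; split; first exact: binpoly_roots_near_Ccurve d0.
have [c [N cN]] := binpoly_root_near_zpoint d0.
exists c, N => r n rn _ Nn da; have [z Bz zc] := cN r n rn Nn da.
have [m mm] := root_dist_min (zpoint R r n) (binpoly_neq0 r n) (ex_intro _ z Bz).
exists m; split=> //; apply: le_trans zc; apply: mm.2.
by exists z.
Qed.
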